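(* Let $\mathfrak{C}\in\{c,B\}$. Every $\preceq^{inj}_{\mathfrak{C}}$-basis for the class of analytic digraphs of uncountable Borel chromatic number on Polish spaces is infinite; i.e., there is no finite family $(X_i,A_i)_{i<N}$ of such digraphs such that every analytic digraph $(X,A)$ of uncountable Borel chromatic number on a Polish space satisfies $(X_i,A_i)\preceq^{inj}_{\mathfrak{C}}(X,A)$ for some $i<N$.
   Context: A digraph on $X$ is a relation $A\subseteq X^2$ disjoint from the diagonal. For relations $A$ on $X$, $B$ on $Y$ (Polish), $(X,A)\preceq^{inj}_c(Y,B)$ (resp. $\preceq^{inj}_B$) means there is an injective continuous (resp. Borel) $h:X\to Y$ with $A\subseteq(h\times h)^{-1}(B)$. The Borel chromatic number of a digraph $A$ on Polish $X$ is the least cardinality of a Polish $Y$ admitting a Borel $c:X\to Y$ with $c(x)\neq c(x')$ for $(x,x')\in A$. *)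

(* Defs.v *)
From Stdlib Require Import Reals.
Open Scope R_scope.

Record Polish : Type := MkPolish {
  pt :> Type;
  dist : pt -> pt -> R;
  dist_nonneg : forall x y, 0 <= dist x y;
  dist_eq0 : forall x y, dist x y = 0 <-> x = y;
  dist_sym : forall x y, dist x y = dist y x;
  dist_tri : forall x y z, dist x z <= dist x y + dist y z;
  complete : forall u : nat -> pt,
    (forall eps, 0 < eps -> exists N, forall m n, (N <= m)%nat -> (N <= n)%nat ->
        dist (u m) (u n) < eps) ->
    exists l, forall eps, 0 < eps -> exists N, forall n, (N <= n)%nat -> dist (u n) l < eps;
  separable : exists D : nat -> option pt,
    forall x eps, 0 < eps -> exists n y, D n = Some y /\ dist x y < eps
}.

Definition is_open (X : Polish) (U : X -> Prop) : Prop :=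
  forall x, U x -> exists eps, 0 < eps /\ forall y, dist X x y < eps -> U y.

Inductive Borel (X : Polish) : (X -> Prop) -> Prop :=
| Borel_open : forall U, is_open X U -> Borel X U
| Borel_compl : forall U, Borel X U -> Borel X (fun x => ~ U x)
| Borel_union : forall F : nat -> X -> Prop,
    (forall n, Borel X (F n)) -> Borel X (fun x => exists n, F n x)
| Borel_ext : forall U V, Borel X U -> (forall x, U x <-> V x) -> Borel X V.

Definition continuous (X Y : Polish) (f : X -> Y) : Prop :=
  forall x eps, 0 < eps -> exists delta, 0 < delta /\
    forall x', dist X x x' < delta -> dist Y (f x) (f x') < eps.

Definition borel_fun (X Y : Polish) (f : X -> Y) : Prop :=
  forall U, is_open Y U -> Borel X (fun x => U (f x)).

Definition injective {A B : Type} (f : A -> B) : Prop :=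
  forall a a', f a = f a' -> a = a'.

Definition digraph (X : Polish) (A : X -> X -> Prop) : Prop :=
  forall x, ~ A x x.

(* Analytic subset of X^2: a continuous image of a Polish space
   (continuity into X x X = continuity of both coordinates). The empty set is
   included since Polish spaces may be empty. *)
Definition analytic2 (X : Polish) (A : X -> X -> Prop) : Prop :=
  exists (Z : Polish) (f g : Z -> X), continuous Z X f /\ continuous Z X g /\
    forall x y, A x y <-> exists z, f z = x /\ g z = y.

Definition countable_type (T : Type) : Prop :=
  exists e : T -> nat, injective e.

Definition uncountable_borel_chromatic (X : Polish) (A : X -> X -> Prop) : Prop :=
  ~ exists (Y : Polish) (c : X -> Y), countable_type Y /\ borel_fun X Y c /\
      forall x x', A x x' -> c x <> c x'.

Definition in_class (X : Polish) (A : X -> X -> Prop) : Prop :=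
  digraph X A /\ analytic2 X A /\ uncountable_borel_chromatic X A.

Inductive Cls := Cont | BorelC.

Definition admissible (C : Cls) (X Y : Polish) (h : X -> Y) : Prop :=
  match C with Cont => continuous X Y h | BorelC => borel_fun X Y h end.

Definition inj_reduces (C : Cls) (X : Polish) (A : X -> X -> Prop)
    (Y : Polish) (B : Y -> Y -> Prop) : Prop :=
  exists h : X -> Y, injective h /\ admissible C X Y h /\
    forall x x', A x x' -> B (h x) (h x').

(* Main.v *)
(* A point of the Baire space is read as [K + 1] layers (further ones are inert), each a
   sequence of coordinates, each coordinate a sequence of columns.  The digraph [A_K] joins
   [x] to [x o tau_a], where the injection [tau_a] keeps everything before coordinate [a],
   copies layer [j] to layer [j + 1] beyond [a], and makes layer [0] beyond [a] a function
   of coordinate [a] alone.  Since [tau_a] tends to the identity and composition with it is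
   category preserving, [A_K] has uncountable Borel chromatic number.

   Call a pair of walks of lengths [j] and [j + 1] with common ends an unbalanced pattern.
   Modulo eventual equality an edge shifts the layers by one and changes layer [0], so [A_K]
   has no such pattern with [j <= K].  Conversely, applying [K + 1] maps with decreasing
   labels erases all trace of a previous map with a larger label.  If [B] embeds in [A_K]
   and is not countably Borel colorable, then one finds, label after label, a large analytic
   set all of whose points have [B]-walks along the same [K + 1] decreasing labels; a
   [B]-edge with a larger label inside this set gives by injectivity an unbalanced pattern
   with [j = K + 1].  Here one uses that a digraph with finitely many labels is countably
   Borel colorable, together with separation by Borel rectangles.  So each member of a
   finite basis has, if any, a pattern of some length, and it is not below [A_K] for
   large [K]. *)

From Stdlib Require Import Reals Lra Lia Arith Cantor Classical ClassicalEpsilon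
  FunctionalExtensionality ProofIrrelevance.
Require Import Defs.
Local Open Scope nat_scope.

(** * Choice, agreement of sequences up to a length, coding of pairs *)

Lemma choice {A B : Type} (R : A -> B -> Prop) :
  (forall x, exists y, R x y) -> exists f, forall x, R x (f x).
Proof.
  intros H.
  exists (fun x => proj1_sig (constructive_indefinite_description _ (H x))).
  intros x. exact (proj2_sig (constructive_indefinite_description _ (H x))).
Qed.

Lemma least_witness (P : nat -> Prop) :
  (exists k, P k) -> exists k, P k /\ forall i, i < k -> ~ P i.
Proof.
  intros [k Hk]. induction k as [k IH] using lt_wf_ind.
  destruct (classic (exists i, i < k /\ P i)) as [[i [Hi Pi]]|H].
  - exact (IH i Hi Pi).
  - exists k. split; [exact Hk|]. intros i Hi Pi. apply H. now exists i.
Qed.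

Definition agree {E : Type} (n : nat) (u v : nat -> E) : Prop :=
  forall i, i < n -> u i = v i.

Lemma agree_refl {E : Type} n (u : nat -> E) : agree n u u.
Proof. intros i _. reflexivity. Qed.

Lemma agree_sym {E : Type} n (u v : nat -> E) : agree n u v -> agree n v u.
Proof. intros H i Hi. symmetry. auto. Qed.

Lemma agree_trans {E : Type} n (u v w : nat -> E) :
  agree n u v -> agree n v w -> agree n u w.
Proof. intros H1 H2 i Hi. rewrite H1, H2; auto. Qed.

Lemma agree_le {E : Type} m n (u v : nat -> E) : m <= n -> agree n u v -> agree m u v.
Proof. intros L H i Hi. apply H. lia. Qed.

Definition fst_of (p : nat) : nat := fst (of_nat p).
Definition snd_of (p : nat) : nat := snd (of_nat p).

Lemma fst_of_pair i j : fst_of (to_nat (i, j)) = i.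
Proof. unfold fst_of. now rewrite cancel_of_to. Qed.

Lemma snd_of_pair i j : snd_of (to_nat (i, j)) = j.
Proof. unfold snd_of. now rewrite cancel_of_to. Qed.

Lemma pair_fst_snd p : to_nat (fst_of p, snd_of p) = p.
Proof. unfold fst_of, snd_of. rewrite <- surjective_pairing. apply cancel_to_of. Qed.

(* [digit k] runs through a family of sequences dense in the Baire space. *)
Fixpoint digit (k i : nat) : nat :=
  match i with 0 => fst_of k | S i => digit (snd_of k) i end.

Lemma digit_dense n (x : nat -> nat) : exists k, agree n (digit k) x.
Proof.
  revert x. induction n as [|n IH]; intros x.
  - exists 0. intros i Hi. lia.
  - destruct (IH (fun i => x (S i))) as [k Hk].
    exists (to_nat (x 0, k)). intros [|i] Hi; cbn [digit].
    + apply fst_of_pair.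
    + rewrite snd_of_pair. apply (Hk i). lia.
Qed.

(** * Closed subspaces of the Baire space *)

Lemma first_difference (u v : nat -> nat) :
  exists r : R, (u = v /\ r = 0%R) \/
    exists k, u k <> v k /\ agree k u v /\ r = (/ INR (S k))%R.
Proof.
  destruct (classic (exists k, u k <> v k)) as [H|H].
  - destruct (least_witness _ H) as [k [Hk Hl]].
    exists (/ INR (S k))%R. right. exists k. repeat split; auto.
    intros i Hi. apply NNPP. exact (Hl i Hi).
  - exists 0%R. left. split; [|reflexivity].
    apply functional_extensionality. intros k. apply NNPP. intros E. apply H. now exists k.
Qed.

(** The usual metric, $1/(k+1)$ for the first difference [k]. The value is picked by description
    because equality of sequences is not decidable. *)
Definition bdist (u v : nat -> nat) : R :=
  proj1_sig (constructive_indefinite_description _ (first_difference u v)).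

Lemma bdist_spec u v : (u = v /\ bdist u v = 0%R) \/
  exists k, u k <> v k /\ agree k u v /\ bdist u v = (/ INR (S k))%R.
Proof. exact (proj2_sig (constructive_indefinite_description _ (first_difference u v))). Qed.

Lemma inv_S_pos k : (0 < / INR (S k))%R.
Proof. apply Rinv_0_lt_compat. apply lt_0_INR. lia. Qed.

Lemma inv_S_le j k : j <= k -> (/ INR (S k) <= / INR (S j))%R.
Proof.
  intros H. apply Rinv_le_contravar. apply lt_0_INR; lia. apply le_INR; lia.
Qed.

Lemma inv_S_lt j k : j < k -> (/ INR (S k) < / INR (S j))%R.
Proof.
  intros H. apply Rinv_lt_contravar.
  - apply Rmult_lt_0_compat; apply lt_0_INR; lia.
  - apply lt_INR; lia.
Qed.

Lemma inv_S_small eps : (0 < eps)%R -> exists n, (/ INR (S n) < eps)%R.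
Proof.
  intros H. destruct (archimed_cor1 eps H) as [n [Hn Hp]].
  exists n. apply Rle_lt_trans with (2 := Hn).
  apply Rinv_le_contravar. apply lt_0_INR; lia. apply le_INR; lia.
Qed.

Lemma bdist_ge u v k : u k <> v k -> (/ INR (S k) <= bdist u v)%R.
Proof.
  intros H. destruct (bdist_spec u v) as [[-> _]|[j [Hj [Ha ->]]]]; [congruence|].
  apply inv_S_le. destruct (le_lt_dec j k); auto. exfalso. apply H. apply Ha. lia.
Qed.

Lemma bdist_nonneg u v : (0 <= bdist u v)%R.
Proof.
  destruct (bdist_spec u v) as [[_ ->]|[k [_ [_ ->]]]]; [lra|].
  pose proof (inv_S_pos k). lra.
Qed.

Lemma bdist_lt_agree u v n : (bdist u v < / INR (S n))%R -> agree (S n) u v.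
Proof.
  intros H i Hi. apply NNPP. intros E. pose proof (bdist_ge u v i E).
  pose proof (inv_S_le i n ltac:(lia)). lra.
Qed.

Lemma agree_bdist_lt u v n : agree (S n) u v -> (bdist u v < / INR (S n))%R.
Proof.
  intros H. destruct (bdist_spec u v) as [[_ ->]|[k [Hk [_ ->]]]].
  - apply inv_S_pos.
  - apply inv_S_lt. destruct (le_lt_dec k n); auto. exfalso. apply Hk, H. lia.
Qed.

Lemma bdist_eq0 u v : bdist u v = 0%R <-> u = v.
Proof.
  destruct (bdist_spec u v) as [[E Z]|[k [Hk [_ E]]]].
  - tauto.
  - split; intros F.
    + pose proof (inv_S_pos k). lra.
    + subst v. congruence.
Qed.

Lemma bdist_sym u v : bdist u v = bdist v u.
Proof.
  assert (L : forall u v, (bdist u v <= bdist v u)%R).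
  { clear. intros u v. destruct (bdist_spec u v) as [[E ->]|[k [Hk [_ ->]]]].
    - apply bdist_nonneg.
    - apply bdist_ge. congruence. }
  apply Rle_antisym; apply L.
Qed.

(** Where [u] and [w] first differ, [v] differs from one of them, so one summand alone is large
    enough. *)
Lemma bdist_tri u v w : (bdist u w <= bdist u v + bdist v w)%R.
Proof.
  pose proof (bdist_nonneg u v). pose proof (bdist_nonneg v w).
  destruct (bdist_spec u w) as [[_ ->]|[k [Hk [_ ->]]]]; [lra|].
  destruct (Nat.eq_dec (u k) (v k)) as [E|E].
  - pose proof (bdist_ge v w k ltac:(congruence)). lra.
  - pose proof (bdist_ge u v k E). lra.
Qed.

Definition pointwise_limit {T : Type} (iota : T -> nat -> nat) (u : nat -> T) (l : nat -> nat) :=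
  forall m, exists N, forall n, N <= n -> iota (u n) m = l m.

Section ClosedSubspace.
Variables (T : Type) (iota : T -> nat -> nat).
Hypothesis iota_inj : injective iota.
Hypothesis iota_closed : forall u l, pointwise_limit iota u l -> exists t, iota t = l.

Let d (s t : T) := bdist (iota s) (iota t).

Lemma subspace_eq0 s t : d s t = 0%R <-> s = t.
Proof.
  unfold d. rewrite bdist_eq0. split; [apply iota_inj|congruence].
Qed.

Lemma subspace_complete : forall u : nat -> T,
  (forall eps, (0 < eps)%R -> exists N, forall m n, N <= m -> N <= n ->
     (d (u m) (u n) < eps)%R) ->
  exists l, forall eps, (0 < eps)%R -> exists N, forall n, N <= n -> (d (u n) l < eps)%R.
Proof.
  intros u H.
  assert (C : forall m, exists v, exists N, forall n, N <= n -> iota (u n) m = v).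
  { intros m. destruct (H (/ INR (S m))%R (inv_S_pos m)) as [N HN].
    exists (iota (u N) m), N. intros n Hn.
    pose proof (HN n N Hn (le_n N)) as L. apply bdist_lt_agree in L. apply L. lia. }
  destruct (choice _ C) as [l Hl].
  destruct (iota_closed u l Hl) as [t Ht]. exists t.
  intros eps He. destruct (inv_S_small eps He) as [k Hk].
  destruct (H (/ INR (S k))%R (inv_S_pos k)) as [N HN]. exists N. intros n Hn.
  apply Rlt_trans with (2 := Hk). apply agree_bdist_lt. intros i Hi. rewrite Ht.
  destruct (Hl i) as [N' HN']. rewrite <- (HN' (max N N')) by lia.
  pose proof (HN n (max N N') Hn ltac:(lia)) as L. apply bdist_lt_agree in L. now apply L.
Qed.

(** The number [n] codes a cylinder, and [D n] is a chosen member of it, or [None] if the cylinder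
    misses the subspace. *)
Lemma subspace_separable : exists D : nat -> option T,
  forall x eps, (0 < eps)%R -> exists n y, D n = Some y /\ (d x y < eps)%R.
Proof.
  assert (C : forall n, exists o : option T, match o with
    | Some t => agree (snd_of n) (digit (fst_of n)) (iota t)
    | None => forall t, ~ agree (snd_of n) (digit (fst_of n)) (iota t) end).
  { intros n. destruct (classic (exists t, agree (snd_of n) (digit (fst_of n)) (iota t))) as [[t H]|H].
    - now exists (Some t).
    - exists None. intros t Ht. apply H. now exists t. }
  destruct (choice _ C) as [D HD]. exists D. intros x eps He.
  destruct (inv_S_small eps He) as [m Hm].
  destruct (digit_dense (S m) (iota x)) as [k Hk].
  exists (to_nat (k, S m)). specialize (HD (to_nat (k, S m))).
  rewrite fst_of_pair, snd_of_pair in HD. destruct (D (to_nat (k, S m))) as [y|].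
  - exists y. split; [reflexivity|]. apply Rlt_trans with (2 := Hm). apply agree_bdist_lt.
    apply agree_trans with (digit k); [now apply agree_sym|assumption].
  - exfalso. exact (HD x Hk).
Qed.

(** One construction serves for the Baire space, for the discrete naturals as constant sequences,
    and later for the space of codes of edges. *)
Definition subspace : Polish :=
  MkPolish T d (fun s t => bdist_nonneg _ _) subspace_eq0 (fun s t => bdist_sym _ _)
    (fun s t r => bdist_tri _ _ _) subspace_complete subspace_separable.

End ClosedSubspace.

Lemma id_injective : injective (fun x : nat -> nat => x).
Proof. intros x y E. exact E. Qed.

Lemma id_closed : forall u l,
  pointwise_limit (fun x : nat -> nat => x) u l -> exists t : nat -> nat, t = l.
Proof. intros u l _. now exists l. Qed.

Definition Baire : Polish := subspace (nat -> nat) (fun x => x) id_injective id_closed.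

Lemma const_injective : injective (fun k _ : nat => k).
Proof. intros x y E. exact (f_equal (fun f => f 0) E). Qed.

Lemma const_closed : forall u l,
  pointwise_limit (fun k _ : nat => k) u l -> exists t, (fun _ => t) = l.
Proof.
  intros u l H. exists (l 0). apply functional_extensionality. intros m.
  destruct (H 0) as [N HN], (H m) as [N' HN'].
  rewrite <- (HN (N + N')), <- (HN' (N + N')); lia.
Qed.

Definition Discrete : Polish := subspace nat (fun k _ => k) const_injective const_closed.

Lemma Baire_open (U : Baire -> Prop) :
  is_open Baire U <-> forall x, U x -> exists n, forall y, agree n x y -> U y.
Proof.
  split; intros H x Ux.
  - destruct (H x Ux) as [eps [He HU]]. destruct (inv_S_small eps He) as [n Hn].
    exists (S n). intros y Hy. apply HU. apply Rlt_trans with (2 := Hn).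
    now apply agree_bdist_lt.
  - destruct (H x Ux) as [n Hn]. exists (/ INR (S n))%R. split; [apply inv_S_pos|].
    intros y Hy. apply Hn. apply agree_le with (S n); [lia|]. now apply bdist_lt_agree.
Qed.

(** * Borel sets and the ideal of countably Borel colorable sets *)

Lemma Borel_inter (X : Polish) (F : nat -> X -> Prop) :
  (forall n, Borel X (F n)) -> Borel X (fun x => forall n, F n x).
Proof.
  intros H.
  apply (Borel_ext X (fun x => ~ exists n, ~ F n x)).
  - apply Borel_compl, (Borel_union X (fun n x => ~ F n x)). intros n. now apply Borel_compl.
  - intros x. split.
    + intros N n. apply NNPP. intros E. apply N. now exists n.
    + intros A [n Hn]. exact (Hn (A n)).
Qed.

Lemma Borel_and (X : Polish) (U V : X -> Prop) :
  Borel X U -> Borel X V -> Borel X (fun x => U x /\ V x).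
Proof.
  intros HU HV.
  apply (Borel_ext X (fun x => forall n, (match n with 0 => U | _ => V end) x)).
  - apply Borel_inter. now intros [|n].
  - intros x. split.
    + intros H. exact (conj (H 0) (H 1)).
    + intros [A B] [|n]; assumption.
Qed.

Lemma Borel_False (X : Polish) : Borel X (fun _ => False).
Proof. apply Borel_open. intros x []. Qed.

Lemma Borel_True (X : Polish) : Borel X (fun _ => True).
Proof. apply Borel_open. intros x _. exists 1%R. split; [lra|auto]. Qed.

Lemma continuous_borel (X Y : Polish) (f : X -> Y) : continuous X Y f -> borel_fun X Y f.
Proof.
  intros H U HU. apply Borel_open. intros x Ux.
  destruct (HU _ Ux) as [eps [He HUe]]. destruct (H x eps He) as [de [Hd Hf]].
  exists de. split; auto.
Qed.

Lemma dist_pos (Y : Polish) (x y : Y) : x <> y -> (0 < dist Y x y)%R.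
Proof.
  intros H. destruct (dist_nonneg Y x y) as [L|E]; [exact L|].
  symmetry in E. apply dist_eq0 in E. contradiction.
Qed.

Lemma Borel_fiber (X Y : Polish) (c : X -> Y) (y : Y) :
  borel_fun X Y c -> Borel X (fun x => c x = y).
Proof.
  intros H. apply (Borel_ext X (fun x => ~ c x <> y)).
  - apply Borel_compl. apply (H (fun z => z <> y)). intros z Hz.
    exists (dist Y z y). split; [now apply dist_pos|].
    intros w Hw ->. exact (Rlt_irrefl _ Hw).
  - intros x. split; [apply NNPP|auto].
Qed.

Lemma Borel_coordinate (Y : Polish) (h : Y -> Baire) p v :
  borel_fun Y Baire h -> Borel Y (fun y => h y p = v).
Proof.
  intros H. apply (H (fun x => x p = v)). apply Baire_open. intros x E.
  exists (S p). intros y Hy. rewrite <- (Hy p); auto.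
Qed.

Definition independent_cover (X : Polish) (A : X -> X -> Prop) (S : X -> Prop)
    (C : nat -> X -> Prop) : Prop :=
  (forall i, Borel X (C i)) /\ (forall i x y, C i x -> C i y -> ~ A x y) /\
  forall x, S x -> exists i, C i x.

(** The sigma-ideal of countably Borel colorable sets. Only the covering sets are Borel, not [S], so
    that analytic [S] are allowed. *)
Definition small (X : Polish) (A : X -> X -> Prop) (S : X -> Prop) : Prop :=
  exists C, independent_cover X A S C.

Lemma colorable_of_small (X : Polish) (A : X -> X -> Prop) :
  small X A (fun _ => True) -> ~ uncountable_borel_chromatic X A.
Proof.
  intros [C [HB [HI HC]]] H. apply H; clear H.
  (* The color of a point is the least index of a covering set containing it, so each color class is
     a Borel difference of covering sets. *)
  assert (L : forall x, exists i, C i x /\ forall j, j < i -> ~ C j x)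
    by (intros x; apply (least_witness (fun i => C i x)); auto).
  destruct (choice _ L) as [c Hc]. exists Discrete, c. split; [|split].
  - exists (fun k => k). intros a b E. exact E.
  - intros U _. apply (Borel_ext X (fun x => exists i, U i /\ c x = i)).
    + apply (Borel_union X (fun i x => U i /\ c x = i)).
      intros i. destruct (classic (U i)) as [Ui|Ui].
      * apply (Borel_ext X (fun x => C i x /\ forall j, ~ (j < i /\ C j x))).
        -- apply Borel_and; [apply HB|]. apply (Borel_inter X (fun j x => ~ (j < i /\ C j x))).
           intros j. apply Borel_compl. destruct (lt_dec j i).
           ++ apply (Borel_ext X (C j)); [apply HB|tauto].
           ++ apply (Borel_ext X (fun _ => False)); [apply Borel_False|tauto].
        -- intros x. destruct (Hc x) as [H1 H2]. split.
           ++ intros [H3 H4]. split; [exact Ui|].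
              destruct (lt_eq_lt_dec (c x) i) as [[l|e]|l]; auto.
              ** exfalso. apply (H4 (c x)). auto.
              ** exfalso. exact (H2 _ l H3).
           ++ intros [_ <-]. split; [exact H1|]. intros j [Hj Cj]. exact (H2 _ Hj Cj).
      * apply (Borel_ext X (fun _ => False)); [apply Borel_False|tauto].
    + intros x. split; [intros [i [Ui <-]]; exact Ui|eauto].
  - intros x y Axy E. apply (HI (c x) x y); [apply Hc| |exact Axy]. rewrite E. apply Hc.
Qed.

Lemma uncountable_of_not_small (X : Polish) (A : X -> X -> Prop) :
  ~ small X A (fun _ => True) -> uncountable_borel_chromatic X A.
Proof.
  intros H [Y [c [[e He] [HB HC]]]]. apply H.
  exists (fun i x => e (c x) = i). split; [|split].
  - intros i. destruct (classic (exists y, e y = i)) as [[y Hy]|N].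
    + apply (Borel_ext X (fun x => c x = y)); [now apply Borel_fiber|].
      intros x. split; [intros ->; exact Hy|]. intros E. apply He. congruence.
    + apply (Borel_ext X (fun _ => False)); [apply Borel_False|].
      intros x. split; [tauto|]. intros E. apply N. now exists (c x).
  - intros i x y E1 E2 Axy. apply (HC x y Axy). apply He. congruence.
  - intros x _. now exists (e (c x)).
Qed.

Lemma small_sub (X : Polish) A (S S' : X -> Prop) :
  (forall x, S x -> S' x) -> small X A S' -> small X A S.
Proof.
  intros H [C [HB [HI HC]]]. exists C. split; [|split]; auto.
Qed.

Lemma small_union (X : Polish) A (S : nat -> X -> Prop) :
  (forall n, small X A (S n)) -> small X A (fun x => exists n, S n x).
Proof.
  intros H. destruct (choice _ H) as [C HC].
  exists (fun k => C (fst_of k) (snd_of k)). split; [|split].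
  - intros k. apply HC.
  - intros k. apply HC.
  - intros x [n Hn]. destruct (HC n) as [_ [_ E]]. destruct (E x Hn) as [i Hi].
    exists (to_nat (n, i)). now rewrite fst_of_pair, snd_of_pair.
Qed.

Lemma small_or (X : Polish) A (S S' : X -> Prop) :
  small X A S -> small X A S' -> small X A (fun x => S x \/ S' x).
Proof.
  intros H H'.
  apply small_sub with (fun x => exists n, (match n with 0 => S | _ => S' end) x).
  - intros x [Hx|Hx]; [now exists 0|now exists 1].
  - apply (small_union X A (fun n => match n with 0 => S | _ => S' end)). now intros [|n].
Qed.

Lemma small_independent (X : Polish) A (S : X -> Prop) :
  Borel X S -> (forall x y, S x -> S y -> ~ A x y) -> small X A S.
Proof.
  intros HB HI. exists (fun _ => S). split; [|split]; auto. intros x Sx. now exists 0.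
Qed.

(** * Baire category *)

Definition nowhere_dense (F : (nat -> nat) -> Prop) : Prop :=
  forall x n, exists y m, n <= m /\ agree n x y /\ forall z, agree m y z -> ~ F z.

Definition meager (M : (nat -> nat) -> Prop) : Prop :=
  exists F, (forall k : nat, nowhere_dense (F k)) /\ forall x, M x -> exists k, F k x.

Lemma nowhere_dense_meager F : nowhere_dense F -> meager F.
Proof. intros H. exists (fun _ => F). split; [auto|]. intros x Fx. now exists 0. Qed.

Lemma meager_sub (M M' : (nat -> nat) -> Prop) :
  (forall x, M x -> M' x) -> meager M' -> meager M.
Proof. intros H [F [HF HM]]. exists F. auto. Qed.

Lemma meager_union (M : nat -> (nat -> nat) -> Prop) :
  (forall k, meager (M k)) -> meager (fun x => exists k, M k x).
Proof.
  intros H. destruct (choice _ H) as [F HF].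
  exists (fun k => F (fst_of k) (snd_of k)). split.
  - intros k. apply HF.
  - intros x [k Hk]. destruct (proj2 (HF k) x Hk) as [i Hi].
    exists (to_nat (k, i)). now rewrite fst_of_pair, snd_of_pair.
Qed.

Lemma meager_or (M M' : (nat -> nat) -> Prop) :
  meager M -> meager M' -> meager (fun x => M x \/ M' x).
Proof.
  intros H H'.
  apply meager_sub with (fun x => exists k, (match k with 0 => M | _ => M' end) x).
  - intros x [Hx|Hx]; [now exists 0|now exists 1].
  - apply (meager_union (fun k => match k with 0 => M | _ => M' end)). now intros [|k].
Qed.

Lemma baire_category M x n : meager M -> exists y, agree n x y /\ ~ M y.
Proof.
  intros [F [HF HM]].
  (* Here [a] is a stage [k] with a cylinder and [b] a smaller cylinder avoiding [F k]. Its length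
     is made strictly larger, so that the cylinders determine a point in the limit. *)
  assert (C : forall a : nat * ((nat -> nat) * nat), exists b : (nat -> nat) * nat,
    snd (snd a) < snd b /\ agree (snd (snd a)) (fst (snd a)) (fst b) /\
    forall z, agree (snd b) (fst b) z -> ~ F (fst a) z).
  { intros [k [y m]]. destruct (HF k y m) as [y' [m' [L [Ha Hz]]]].
    exists (y', S m'). cbn. split; [lia|split; [exact Ha|]].
    intros z Az. apply Hz. apply agree_le with (S m'); [lia|exact Az]. }
  destruct (choice _ C) as [g Hg].
  pose (s := fix s k := match k with 0 => (x, n) | S k => g (k, s k) end).
  assert (Hs : forall k, snd (s k) < snd (s (S k)) /\
    agree (snd (s k)) (fst (s k)) (fst (s (S k))) /\
    forall z, agree (snd (s (S k))) (fst (s (S k))) z -> ~ F k z)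
    by (intros k; exact (Hg (k, s k))).
  assert (Lk : forall k, k <= snd (s k)).
  { induction k as [|k IH]; [lia|]. destruct (Hs k) as [L _]. lia. }
  assert (Mono : forall d k, agree (snd (s k)) (fst (s k)) (fst (s (d + k))) /\
    snd (s k) <= snd (s (d + k))).
  { induction d as [|d IH]; intros k; [split; [apply agree_refl|apply le_n]|].
    destruct (IH k) as [A L]. destruct (Hs (d + k)) as [L' [A' _]].
    change (S d + k) with (S (d + k)). split; [|lia].
    apply agree_trans with (1 := A). now apply agree_le with (2 := A'). }
  (* By [Lk], stage [S i] has already fixed the value at [i]. *)
  pose (y := fun i => fst (s (S i)) i).
  assert (Hy : forall k, agree (snd (s k)) (fst (s k)) y).
  { intros k i Hi. unfold y. destruct (le_lt_dec k (S i)) as [L|L].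
    - destruct (Mono (S i - k) k) as [A _]. rewrite Nat.sub_add in A by exact L. auto.
    - destruct (Mono (k - S i) (S i)) as [A _]. rewrite Nat.sub_add in A by lia.
      symmetry. apply A. pose proof (Lk (S i)). lia. }
  exists y. split; [exact (Hy 0)|].
  intros My. destruct (HM y My) as [k Fk]. destruct (Hs k) as [_ [_ H]]. exact (H y (Hy (S k)) Fk).
Qed.

Definition meager_in (n : nat) (x : nat -> nat) (M : (nat -> nat) -> Prop) : Prop :=
  meager (fun z => agree n x z /\ M z).

(** There are only countably many cylinders, so the union of those in which [M] is meager
    contributes a meager part; by hypothesis this union leaves a nowhere dense part of the given
    cylinder. *)
Lemma meager_in_local M x0 n0 :
  (forall x n, n0 <= n -> agree n0 x0 x ->
     exists y m, n <= m /\ agree n x y /\ meager_in m y M) ->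
  meager_in n0 x0 M.
Proof.
  intros H.
  pose (U := fun j z => meager_in (snd_of j) (digit (fst_of j)) M /\
                        agree (snd_of j) (digit (fst_of j)) z).
  apply meager_sub with (fun z => (agree n0 x0 z /\ forall j, ~ U j z) \/ exists j, U j z /\ M z).
  - intros z [Az Mz]. destruct (classic (exists j, U j z)) as [[j Uj]|N].
    + right. now exists j.
    + left. split; [exact Az|]. intros j Uj. apply N. now exists j.
  - apply meager_or.
    + apply nowhere_dense_meager. intros x n.
      destruct (classic (agree n0 x0 x)) as [A|N].
      * destruct (H x (max n n0) ltac:(lia) A) as [y [m [L [Axy My]]]].
        destruct (digit_dense m y) as [k Hk].
        exists y, m. split; [lia|split; [apply agree_le with (2 := Axy); lia|]].
        intros z Az [_ Nz]. apply (Nz (to_nat (k, m))). unfold U.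
        rewrite fst_of_pair, snd_of_pair. split.
        -- apply meager_sub with (2 := My). intros t [At Mt]. split; [|exact Mt].
           apply agree_trans with (2 := At). now apply agree_sym.
        -- now apply agree_trans with (2 := Az).
      * exists x, (max n n0). split; [lia|split; [apply agree_refl|]].
        intros z Az [A _]. apply N. apply agree_trans with (1 := A).
        apply agree_sym. apply agree_le with (2 := Az). lia.
    + apply (meager_union (fun j z => U j z /\ M z)). intros j.
      destruct (classic (meager_in (snd_of j) (digit (fst_of j)) M)) as [Y|N].
      * apply meager_sub with (2 := Y). unfold U. tauto.
      * apply meager_sub with (fun _ => False); [unfold U; tauto|].
        apply nowhere_dense_meager. intros x n. exists x, n.
        split; [apply le_n|split; [apply agree_refl|tauto]].
Qed.

(** A local form of the Baire property, symmetric under complement so that the induction runs. For a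
    union, either some member is comeager in a smaller cylinder, or every member is meager in
    densely many smaller ones and [meager_in_local] applies. *)
Lemma Borel_baire_property (C : Baire -> Prop) : Borel Baire C ->
  forall x n, exists y m, n <= m /\ agree n x y /\
    (meager_in m y C \/ meager_in m y (fun z => ~ C z)).
Proof.
  assert (E : forall M : (nat -> nat) -> Prop, (forall z, ~ M z) -> meager M).
  { intros M H. apply meager_sub with (fun _ => False); [exact H|].
    apply nowhere_dense_meager. intros x n. exists x, n.
    split; [apply le_n|split; [apply agree_refl|tauto]]. }
  induction 1 as [U HU|U _ IH|F _ IH|U V _ IH HUV]; intros x n.
  - rewrite Baire_open in HU.
    destruct (classic (exists y, agree n x y /\ U y)) as [[y [A Uy]]|N].
    + destruct (HU y Uy) as [m Hm]. exists y, (max n m).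
      split; [lia|split; [exact A|]]. right. apply E. intros z [Az NUz]. apply NUz.
      apply Hm. apply agree_le with (2 := Az). lia.
    + exists x, n. split; [apply le_n|split; [apply agree_refl|]].
      left. apply E. intros z [Az Uz]. apply N. now exists z.
  - destruct (IH x n) as [y [m [L [A [H|H]]]]]; exists y, m; (split; [exact L|split; [exact A|]]).
    + right. apply meager_sub with (2 := H). intros z [Az Uz]. split; [exact Az|].
      now apply NNPP.
    + left. exact H.
  - destruct (classic (exists k y m, n <= m /\ agree n x y /\ meager_in m y (fun z => ~ F k z)))
      as [[k [y [m [L [A H]]]]]|N].
    + exists y, m. split; [exact L|split; [exact A|]]. right.
      apply meager_sub with (2 := H). intros z [Az NF]. split; [exact Az|].
      intros Fk. apply NF. now exists k.
    + exists x, n. split; [apply le_n|split; [apply agree_refl|]]. left.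
      apply meager_sub with (fun z => exists k, agree n x z /\ F k z).
      { intros z [Az [k Fk]]. now exists k. }
      apply (meager_union (fun k z => agree n x z /\ F k z)). intros k.
      apply meager_in_local. intros x' n' L A.
      destruct (IH k x' n') as [y [m [L' [A' [H|H]]]]]; [now exists y, m|].
      exfalso. apply N. exists k, y, m. split; [lia|split; [|exact H]].
      apply agree_trans with (1 := A). now apply agree_le with (2 := A').
  - destruct (IH x n) as [y [m [L [A H]]]]. exists y, m. split; [exact L|split; [exact A|]].
    destruct H as [H|H]; [left|right]; apply meager_sub with (2 := H);
      intros z [Az Hz]; (split; [exact Az|]); specialize (HUV z); tauto.
Qed.

Lemma injective_preimage_bounded (tau : nat -> nat) n : injective tau ->
  exists L, forall p, tau p < n -> p < L.
Proof.
  intros Ht. induction n as [|n [L IH]].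
  - exists 0. intros p Hp. lia.
  - destruct (classic (exists p, tau p = n)) as [[q Hq]|N].
    + exists (max L (S q)). intros p Hp. destruct (Nat.eq_dec (tau p) n) as [e|e].
      * assert (p = q) by (apply Ht; congruence). lia.
      * specialize (IH p ltac:(lia)). lia.
    + exists L. intros p Hp. apply IH. assert (tau p <> n) by (intros e; apply N; now exists p). lia.
Qed.

Lemma bounded_values (tau : nat -> nat) n : exists L, forall p, p < n -> tau p < L.
Proof.
  induction n as [|n [L IH]].
  - exists 0. lia.
  - exists (max L (S (tau n))). intros p Hp. destruct (Nat.eq_dec p n) as [->|e]; [lia|].
    specialize (IH p ltac:(lia)). lia.
Qed.

(* [x |-> x o tau] is continuous and open when [tau] is injective. *)
Lemma nowhere_dense_reindex (tau : nat -> nat) F : injective tau -> nowhere_dense F ->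
  nowhere_dense (fun x => F (fun p => x (tau p))).
Proof.
  (* Entries [p >= L] are read at places [tau p >= n], where the point may still be changed. *)
  intros Ht HF x n. destruct (injective_preimage_bounded tau n Ht) as [L HL].
  destruct (HF (fun p => x (tau p)) L) as [y [m [Lm [A Hy]]]].
  destruct (bounded_values tau m) as [M HM].
  assert (C : forall q, exists v, (q < n -> v = x q) /\
    (n <= q -> forall p, p < m -> tau p = q -> v = y p)).
  { intros q. destruct (le_lt_dec n q) as [l|l].
    - destruct (classic (exists p, p < m /\ tau p = q)) as [[p [Hp Hq]]|N].
      + exists (y p). split; [lia|]. intros _ p' _ Hq'. f_equal. apply Ht. congruence.
      + exists 0. split; [lia|]. intros _ p Hp Hq. exfalso. apply N. now exists p.
    - exists (x q). split; [auto|lia]. }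
  destruct (choice _ C) as [w Hw].
  exists w, (max n M). split; [lia|split].
  - intros i Hi. symmetry. now apply Hw.
  - intros z Az. apply Hy. intros p Hp.
    specialize (HM p Hp). rewrite <- (Az (tau p)) by lia.
    destruct (le_lt_dec n (tau p)) as [l|l].
    + symmetry. now apply (proj2 (Hw (tau p)) l).
    + rewrite (proj1 (Hw (tau p)) l). symmetry. apply A. auto.
Qed.

Lemma meager_reindex (tau : nat -> nat) M : injective tau -> meager M ->
  meager (fun x => M (fun p => x (tau p))).
Proof.
  intros Ht [F [HF HM]]. exists (fun k x => F k (fun p => x (tau p))). split.
  - intros k. now apply nowhere_dense_reindex.
  - intros x Mx. exact (HM _ Mx).
Qed.

Definition reindex_graph (tau : nat -> nat -> nat) (G : nat -> (nat -> nat) -> Prop)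
    (x y : nat -> nat) : Prop :=
  exists a, y = (fun p => x (tau a p)) /\ G a x.

(* A nonmeager Borel set is comeager in some cylinder, which [x |-> x o tau a]
   maps into itself for large [a]. *)
Lemma reindex_graph_not_small tau G :
  (forall a, injective (tau a)) ->
  (forall p, exists N, forall a, N <= a -> tau a p = p) ->
  (forall a, meager (fun x => ~ G a x)) ->
  ~ small Baire (reindex_graph tau G) (fun _ => True).
Proof.
  intros Ht Hid HG [C [HB [HI HC]]].
  assert (K : exists i x n, meager_in n x (fun z => ~ C i z)).
  { apply NNPP. intros N.
    destruct (baire_category (fun z => exists i, C i z) (fun _ => 0) 0) as [y [_ Hy]].
    - apply (meager_union C). intros i.
      apply meager_sub with (fun z => agree 0 (fun _ => 0) z /\ C i z).
      { intros z Cz. split; [intros j Hj; lia|exact Cz]. }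
      apply meager_in_local. intros x n _ _.
      destruct (Borel_baire_property (C i) (HB i) x n) as [y [m [L [A [H|H]]]]].
      + now exists y, m.
      + exfalso. apply N. now exists i, y, m.
    - apply Hy. now apply HC. }
  destruct K as [i [x [n H]]].
  assert (Ha : exists a, forall p, p < n -> tau a p = p).
  { assert (Hb : exists N, forall a, N <= a -> forall p, p < n -> tau a p = p).
    { clear - Hid. induction n as [|n [N IH]].
      - exists 0. lia.
      - destruct (Hid n) as [N' HN']. exists (max N N'). intros a La p Hp.
        destruct (Nat.eq_dec p n) as [->|e]; [apply HN'; lia|apply IH; lia]. }
    destruct Hb as [N HN]. exists N. auto. }
  destruct Ha as [a Ha].
  (* A generic [y] of the cylinder lies in [C i] together with its image and satisfies [G a], which
     is an edge inside [C i]. *)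
  destruct (baire_category (fun z => (agree n x z /\ ~ C i z) \/
     (agree n x (fun p => z (tau a p)) /\ ~ C i (fun p => z (tau a p))) \/ ~ G a z) x n)
    as [y [Ay Hy]].
  - apply meager_or; [exact H|]. apply meager_or; [|apply HG].
    now apply (meager_reindex (tau a) (fun z => agree n x z /\ ~ C i z)).
  - apply (HI i y (fun p => y (tau a p))).
    + apply NNPP. tauto.
    + apply NNPP. intros NC. apply Hy. right. left. split; [|exact NC].
      intros p Hp. rewrite Ha; auto.
    + exists a. split; [reflexivity|]. apply NNPP. tauto.
Qed.

(** * Souslin sets *)

(** An abstract ball relation lets the same closure properties apply to a Polish space and to its
    square, which is given no [Polish] structure. *)
Definition neighborhoods (T : Type) : Type := T -> R -> T -> Prop.

Definition separated {T : Type} (ball : neighborhoods T) : Prop :=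
  forall l l', (forall eps, (0 < eps)%R -> exists y, ball l eps y /\ ball l' eps y) -> l = l'.

Definition ball_continuous {T T' : Type} (ball : neighborhoods T) (ball' : neighborhoods T')
    (f : T -> T') : Prop :=
  forall t eps, (0 < eps)%R -> exists de, (0 < de)%R /\
    forall t', ball t de t' -> ball' (f t) eps (f t').

(* [kappa] picks for each point of [S] a branch of a Souslin scheme for [S]. *)
Definition scheme {T : Type} (ball : neighborhoods T) (S : T -> Prop)
    (kappa : T -> nat -> nat) : Prop :=
  forall alpha, (forall n, exists y, S y /\ agree n (kappa y) alpha) ->
  exists l, S l /\ forall eps, (0 < eps)%R -> exists n, forall y, S y ->
    agree n (kappa y) alpha -> ball l eps y.

Definition souslin {T : Type} (ball : neighborhoods T) (S : T -> Prop) : Prop :=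
  exists kappa, scheme ball S kappa.

Lemma souslin_ext {T : Type} (ball : neighborhoods T) (S S' : T -> Prop) :
  (forall x, S x <-> S' x) -> souslin ball S -> souslin ball S'.
Proof.
  intros H [kappa K]. exists kappa. intros alpha Ha. destruct (K alpha) as [l [Sl Hl]].
  - intros n. destruct (Ha n) as [y [Sy Ay]]. exists y. split; [now apply H|exact Ay].
  - exists l. split; [now apply H|]. intros eps He. destruct (Hl eps He) as [n Hn].
    exists n. intros y Sy. apply Hn. now apply H.
Qed.

(** Entry 0 of a branch names the member of the union, and the remaining entries follow the branch
    in the scheme of that member. *)
Lemma souslin_union {T : Type} (ball : neighborhoods T) (S : nat -> T -> Prop) :
  (forall k, souslin ball (S k)) -> souslin ball (fun x => exists k, S k x).
Proof.
  intros H. destruct (choice _ H) as [kappa K].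
  assert (C : forall x, exists k, (exists j, S j x) -> S k x).
  { intros x. destruct (classic (exists j, S j x)) as [[j Hj]|N]; [now exists j|exists 0; tauto]. }
  destruct (choice _ C) as [k Hk].
  exists (fun x i => match i with 0 => k x | Datatypes.S i => kappa (k x) x i end).
  intros alpha Ha.
  destruct (K (alpha 0) (fun i => alpha (Datatypes.S i))) as [l [Sl Hl]].
  - intros n. destruct (Ha (Datatypes.S n)) as [y [Sy Ay]]. exists y.
    pose proof (Ay 0 ltac:(lia)) as E. cbn in E. rewrite <- E. split; [now apply Hk|].
    intros i Hi. apply (Ay (Datatypes.S i)). lia.
  - exists l. split; [now exists (alpha 0)|]. intros eps He. destruct (Hl eps He) as [n Hn].
    exists (Datatypes.S n). intros y Sy Ay.
    pose proof (Ay 0 ltac:(lia)) as E. cbn in E. apply Hn.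
    + rewrite <- E. now apply Hk.
    + intros i Hi. rewrite <- E. apply (Ay (Datatypes.S i)). lia.
Qed.

(** The branches for all [k] are interleaved. The limits found for different [k] coincide by
    separation, since the same points of the intersection approach all of them. *)
Lemma souslin_inter {T : Type} (ball : neighborhoods T) (S : nat -> T -> Prop) :
  separated ball ->
  (forall k, souslin ball (S k)) -> souslin ball (fun x => forall k, S k x).
Proof.
  intros Hsep H. destruct (choice _ H) as [kappa K].
  exists (fun x i => kappa (fst_of i) x (snd_of i)).
  intros alpha Ha.
  assert (B : forall k n, exists N, forall y,
    agree N (fun i => kappa (fst_of i) y (snd_of i)) alpha ->
    agree n (kappa k y) (fun i => alpha (to_nat (k, i)))).
  { intros k n. destruct (bounded_values (fun i => to_nat (k, i)) n) as [N HN].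
    exists N. intros y Ay i Hi. specialize (Ay _ (HN i Hi)). cbv beta in Ay.
    now rewrite fst_of_pair, snd_of_pair in Ay. }
  assert (L : forall k, exists l, S k l /\ forall eps, (0 < eps)%R -> exists n, forall y,
    (forall k, S k y) -> agree n (fun i => kappa (fst_of i) y (snd_of i)) alpha -> ball l eps y).
  { intros k. destruct (K k (fun i => alpha (to_nat (k, i)))) as [l [Sl Hl]].
    - intros n. destruct (B k n) as [N HN]. destruct (Ha N) as [y [Sy Ay]]. exists y. auto.
    - exists l. split; [exact Sl|]. intros eps He. destruct (Hl eps He) as [n Hn].
      destruct (B k n) as [N HN]. exists N. auto. }
  destruct (choice _ L) as [l Hl].
  exists (l 0). split; [|apply Hl]. intros k.
  replace (l 0) with (l k); [apply Hl|].
  apply Hsep. intros eps He.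
  destruct (proj2 (Hl k) eps He) as [n Hn]. destruct (proj2 (Hl 0) eps He) as [n' Hn'].
  destruct (Ha (max n n')) as [y [Sy Ay]]. exists y.
  split; [apply Hn|apply Hn']; auto; apply agree_le with (2 := Ay); lia.
Qed.

Lemma souslin_and {T : Type} (ball : neighborhoods T) (S S' : T -> Prop) :
  separated ball -> souslin ball S -> souslin ball S' -> souslin ball (fun x => S x /\ S' x).
Proof.
  intros Hsep H H'.
  apply souslin_ext with (fun x => forall k, (match k with 0 => S | _ => S' end) x).
  - intros x. split; [intros A; exact (conj (A 0) (A 1))|]. intros [A B] [|k]; assumption.
  - apply (souslin_inter ball (fun k => match k with 0 => S | _ => S' end)); [exact Hsep|].
    now intros [|k].
Qed.

(** The scheme for [S] converges only in the target; intersecting with [G] supplies a limit in the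
    source, and continuity with separation identifies its image with the limit in [S]. *)
Lemma souslin_preimage {T T' : Type} (ball : neighborhoods T) (ball' : neighborhoods T')
    (f : T -> T') (G : T -> Prop) (S : T' -> Prop) :
  separated ball' -> ball_continuous ball ball' f ->
  souslin ball G -> souslin ball' S -> souslin ball (fun x => G x /\ S (f x)).
Proof.
  intros Hsep Hf [kG KG] [kS KS].
  exists (fun x i => to_nat (kG x i, kS (f x) i)).
  intros alpha Ha.
  assert (BG : forall n y, agree n (fun i => to_nat (kG y i, kS (f y) i)) alpha ->
    agree n (kG y) (fun i => fst_of (alpha i))).
  { intros n y Ay i Hi. rewrite <- (Ay i Hi). now rewrite fst_of_pair. }
  assert (BS : forall n y, agree n (fun i => to_nat (kG y i, kS (f y) i)) alpha ->
    agree n (kS (f y)) (fun i => snd_of (alpha i))).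
  { intros n y Ay i Hi. rewrite <- (Ay i Hi). now rewrite snd_of_pair. }
  destruct (KG (fun i => fst_of (alpha i))) as [l [Gl Hl]].
  { intros n. destruct (Ha n) as [y [[Gy _] Ay]]. exists y. auto. }
  destruct (KS (fun i => snd_of (alpha i))) as [l' [Sl' Hl']].
  { intros n. destruct (Ha n) as [y [[_ Sy] Ay]]. exists (f y). auto. }
  assert (E : f l = l').
  { apply Hsep. intros eps He. destruct (Hf l eps He) as [de [Hd Hfd]].
    destruct (Hl de Hd) as [n Hn]. destruct (Hl' eps He) as [n' Hn'].
    destruct (Ha (max n n')) as [y [[Gy Sy] Ay]]. exists (f y). split.
    - apply Hfd, Hn; [exact Gy|]. apply BG. apply agree_le with (2 := Ay). lia.
    - apply Hn'; [exact Sy|]. apply BS. apply agree_le with (2 := Ay). lia. }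
  exists l. split; [split; [exact Gl|now rewrite E]|].
  intros eps He. destruct (Hl eps He) as [n Hn]. exists n. intros y [Gy _] Ay. auto.
Qed.

(** A point of the image takes over the branch of a chosen preimage. *)
Lemma souslin_image {T T' : Type} (ball : neighborhoods T) (ball' : neighborhoods T')
    (f : T -> T') (G : T -> Prop) :
  ball_continuous ball ball' f -> souslin ball G ->
  souslin ball' (fun y => exists x, G x /\ f x = y).
Proof.
  intros Hf [kappa K].
  assert (C : forall y, exists k : nat -> nat, (exists x, G x /\ f x = y) ->
    exists x, G x /\ f x = y /\ kappa x = k).
  { intros y. destruct (classic (exists x, G x /\ f x = y)) as [[x [Gx E]]|N].
    - exists (kappa x). intros _. now exists x.
    - exists (fun _ => 0). tauto. }
  destruct (choice _ C) as [k Hk]. exists k. intros alpha Ha.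
  destruct (K alpha) as [l [Gl Hl]].
  - intros n. destruct (Ha n) as [y [Gy Ay]]. destruct (Hk y Gy) as [x [Gx [_ E]]].
    exists x. split; [exact Gx|now rewrite E].
  - exists (f l). split; [now exists l|]. intros eps He.
    destruct (Hf l eps He) as [de [Hd Hfd]]. destruct (Hl de Hd) as [n Hn].
    exists n. intros y Gy Ay. destruct (Hk y Gy) as [x [Gx [<- E]]]. apply Hfd, Hn; [exact Gx|].
    now rewrite E.
Qed.

(** * Borel and analytic sets in Polish spaces are Souslin *)

Definition pball (Y : Polish) : neighborhoods Y := fun x eps y => (dist Y x y < eps)%R.

Definition pball2 (Y : Polish) : neighborhoods (Y * Y) := fun x eps y =>
  (dist Y (fst x) (fst y) < eps)%R /\ (dist Y (snd x) (snd y) < eps)%R.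

Lemma dist_refl (Y : Polish) (x : Y) : dist Y x x = 0%R.
Proof. now apply dist_eq0. Qed.

Lemma pball_separated (Y : Polish) : separated (pball Y).
Proof.
  intros l l' H. apply NNPP. intros N. apply dist_pos in N.
  destruct (H (dist Y l l' / 2)%R ltac:(lra)) as [y [H1 H2]]. unfold pball in *.
  pose proof (dist_tri Y l y l'). rewrite (dist_sym Y y l') in *. lra.
Qed.

Lemma pball2_separated (Y : Polish) : separated (pball2 Y).
Proof.
  intros [a b] [a' b'] H. f_equal; apply pball_separated; intros eps He;
    destruct (H eps He) as [[u v] [[H1 H2] [H3 H4]]]; [exists u|exists v]; now split.
Qed.

Lemma fst_ball_continuous (Y : Polish) : ball_continuous (pball2 Y) (pball Y) fst.
Proof. intros t eps He. exists eps. split; [exact He|]. now intros t' []. Qed.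

Lemma snd_ball_continuous (Y : Polish) : ball_continuous (pball2 Y) (pball Y) snd.
Proof. intros t eps He. exists eps. split; [exact He|]. now intros t' []. Qed.

(** Entry [n] of the branch of [y] is the index of a dense point within $1/(n+1)$ of [y]. Points
    following a branch ever longer form a Cauchy sequence, and completeness gives the limit. *)
Lemma souslin_full (Y : Polish) : souslin (pball Y) (fun _ => True).
Proof.
  destruct (separable Y) as [D HD].
  assert (C : forall p : Y * nat, exists k y, D k = Some y /\
    (dist Y (fst p) y < / INR (S (snd p)))%R).
  { intros [y n]. apply (HD y). apply inv_S_pos. }
  destruct (choice _ C) as [k Hk]. exists (fun y n => k (y, n)). intros alpha Ha.
  assert (B : forall n y y', agree (S n) (fun i => k (y, i)) alpha ->
    agree (S n) (fun i => k (y', i)) alpha -> (dist Y y y' < 2 * / INR (S n))%R).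
  { intros n y y' A A'. pose proof (A n ltac:(lia)) as E. pose proof (A' n ltac:(lia)) as E'.
    cbn in E, E'.
    destruct (Hk (y, n)) as [d [Hd Hy]]. destruct (Hk (y', n)) as [d' [Hd' Hy']].
    rewrite E in Hd. rewrite E' in Hd'. assert (d' = d) by congruence. subst d'.
    cbn [fst snd] in *. pose proof (dist_tri Y y d y'). rewrite (dist_sym Y d y') in *. lra. }
  destruct (choice _ Ha) as [u Hu].
  destruct (complete Y u) as [l Hl].
  { intros eps He. destruct (inv_S_small (eps / 2) ltac:(lra)) as [n Hn]. exists (S n).
    intros i j Hi Hj. apply Rlt_trans with (2 * / INR (S n))%R; [|lra].
    apply B; [apply agree_le with (2 := proj2 (Hu i))|apply agree_le with (2 := proj2 (Hu j))]; lia. }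
  exists l. split; [exact I|]. intros eps He.
  (* Points sharing entry [n] are within $2/(n+1)$, hence [eps / 2], of each other; the other half
     pays for the convergence of [u]. *)
  destruct (inv_S_small (eps / 4) ltac:(lra)) as [n Hn]. exists (S n). intros y _ Ay.
  destruct (Hl (eps / 2)%R ltac:(lra)) as [N HN].
  pose (m := max N (S n)). specialize (HN m ltac:(lia)).
  assert (Hm : (dist Y (u m) y < 2 * / INR (S n))%R).
  { apply B; [|exact Ay]. apply agree_le with (2 := proj2 (Hu m)). lia. }
  unfold pball. pose proof (dist_tri Y l (u m) y). rewrite (dist_sym Y l (u m)) in *. lra.
Qed.

Lemma souslin_closed (Y : Polish) (U : Y -> Prop) : is_open Y U -> souslin (pball Y) (fun y => ~ U y).
Proof.
  intros HU. destruct (souslin_full Y) as [kappa K]. exists kappa. intros alpha Ha.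
  destruct (K alpha) as [l [_ Hl]].
  - intros n. destruct (Ha n) as [y [_ Ay]]. now exists y.
  - exists l. split.
    + intros Ul. destruct (HU l Ul) as [eps [He HUe]]. destruct (Hl eps He) as [n Hn].
      destruct (Ha n) as [y [NUy Ay]]. apply NUy, HUe. now apply Hn.
    + intros eps He. destruct (Hl eps He) as [n Hn]. exists n. auto.
Qed.

(** An open set is the countable union of the closed sets of points whose ball of radius $1/(n+1)$
    stays inside it. *)
Lemma souslin_open (Y : Polish) (U : Y -> Prop) : is_open Y U -> souslin (pball Y) U.
Proof.
  intros HU.
  apply souslin_ext with (fun y => exists n, ~ exists z, (dist Y y z < / INR (S n))%R /\ ~ U z).
  - intros y. split.
    + intros [n H]. apply NNPP. intros N. apply H. exists y. split; [|exact N].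
      rewrite dist_refl. apply inv_S_pos.
    + intros Uy. destruct (HU y Uy) as [eps [He H]]. destruct (inv_S_small eps He) as [n Hn].
      exists n. intros [z [Hz NU]]. apply NU, H. lra.
  - apply (souslin_union (pball Y) (fun n y => ~ exists z, (dist Y y z < / INR (S n))%R /\ ~ U z)).
    intros n. apply souslin_closed. intros y [z [Hz NU]].
    exists (/ INR (S n) - dist Y y z)%R. split; [lra|]. intros y' Hy'. exists z.
    split; [|exact NU]. pose proof (dist_tri Y y' y z). rewrite (dist_sym Y y' y) in *. lra.
Qed.

(** The complement is carried through the induction, as Souslin sets need not be closed under
    complement. *)
Lemma Borel_souslin (Y : Polish) (U : Y -> Prop) : Borel Y U ->
  souslin (pball Y) U /\ souslin (pball Y) (fun y => ~ U y).
Proof.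
  induction 1 as [U HU|U _ [IH1 IH2]|F _ IH|U V _ [IH1 IH2] HUV].
  - split; [now apply souslin_open|now apply souslin_closed].
  - split; [exact IH2|]. apply souslin_ext with (2 := IH1).
    intros x. split; [auto|apply NNPP].
  - split.
    + apply souslin_union. intros n. apply IH.
    + apply souslin_ext with (fun y => forall n, ~ F n y).
      * intros x. split; [intros H [n Hn]; exact (H n Hn)|eauto].
      * apply (souslin_inter (pball Y) (fun n y => ~ F n y)); [apply pball_separated|].
        intros n. apply IH.
  - split; [apply souslin_ext with (2 := IH1)|apply souslin_ext with (2 := IH2)];
      intros x; specialize (HUV x); tauto.
Qed.

Lemma analytic2_souslin (Y : Polish) (B : Y -> Y -> Prop) :
  analytic2 Y B -> souslin (pball2 Y) (fun e => B (fst e) (snd e)).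
Proof.
  intros [Z [f [g [Hf [Hg HB]]]]].
  apply souslin_ext with (fun e => exists z, True /\ (f z, g z) = e).
  - intros [a b]. cbn. rewrite HB. split.
    + intros [z [_ E]]. inversion E. now exists z.
    + intros [z [<- <-]]. now exists z.
  - apply (souslin_image (pball Z) (pball2 Y) (fun z => (f z, g z))); [|apply souslin_full].
    intros z eps He. destruct (Hf z eps He) as [d [Hd Hfd]]. destruct (Hg z eps He) as [d' [Hd' Hgd]].
    exists (Rmin d d'). split; [now apply Rmin_pos|]. unfold pball. intros z' Hz. split.
    + apply Hfd. apply Rlt_le_trans with (1 := Hz). apply Rmin_l.
    + apply Hgd. apply Rlt_le_trans with (1 := Hz). apply Rmin_r.
Qed.

(** * Separation by Borel rectangles *)

Definition update {E : Type} (a : nat -> E) (n : nat) (e : E) : nat -> E :=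
  fun i => if i =? n then e else a i.

Lemma update_same {E : Type} (a : nat -> E) n e : update a n e n = e.
Proof. unfold update. now rewrite Nat.eqb_refl. Qed.

Lemma agree_update {E : Type} (a : nat -> E) n e : agree n a (update a n e).
Proof.
  intros i Hi. unfold update. destruct (Nat.eqb_spec i n); [lia|reflexivity].
Qed.

(** Dependent choice: since [Q n] sees only the first [n] entries, extensions chosen one entry at a
    time fit into a single sequence. *)
Lemma branch_of_extensions {E : Type} (Q : nat -> (nat -> E) -> Prop) (a0 : nat -> E) :
  (forall n a b, agree n a b -> Q n a -> Q n b) -> Q 0 a0 ->
  (forall n a, Q n a -> exists e, Q (S n) (update a n e)) ->
  exists a, forall n, Q n a.
Proof.
  intros Hext H0 HS.
  assert (C : forall p : nat * (nat -> E), exists e, Q (fst p) (snd p) ->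
    Q (S (fst p)) (update (snd p) (fst p) e)).
  { intros [n a]. destruct (classic (Q n a)) as [q|q].
    - destruct (HS n a q) as [e He]. exists e. auto.
    - exists (a 0). tauto. }
  destruct (choice _ C) as [e He].
  pose (s := fix s n := match n with 0 => a0 | S n => update (s n) n (e (n, s n)) end).
  assert (Hs : forall n, Q n (s n)).
  { induction n as [|n IH]; [exact H0|]. exact (He (n, s n) IH). }
  assert (Mono : forall d n, agree n (s n) (s (d + n))).
  { induction d as [|d IH]; intros n; [apply agree_refl|].
    apply agree_trans with (1 := IH n). change (S d + n) with (S (d + n)).
    apply agree_le with (d + n); [lia|]. apply agree_update. }
  exists (fun i => s (S i) i). intros n. apply Hext with (2 := Hs n).
  intros i Hi. symmetry. pose proof (Mono (n - S i) (S i) i ltac:(lia)) as E1.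
  rewrite Nat.sub_add in E1 by lia. exact E1.
Qed.

Section Rectangles.
Variable Y : Polish.

Definition rectangle_separated (P Q : Y -> Prop) (G : Y * Y -> Prop) : Prop :=
  exists C D : Y -> Prop, Borel Y C /\ Borel Y D /\ (forall y, P y -> C y) /\
    (forall y, Q y -> D y) /\ forall e, G e -> C (fst e) -> D (snd e) -> False.

Lemma rectangle_separated_union (P Q : nat -> Y -> Prop) (G : nat -> Y * Y -> Prop) :
  (forall i j k, rectangle_separated (P i) (Q j) (G k)) ->
  rectangle_separated (fun y => exists i, P i y) (fun y => exists j, Q j y)
    (fun e => exists k, G k e).
Proof.
  intros H.
  assert (H' : forall t : nat * nat * nat, exists CD : (Y -> Prop) * (Y -> Prop),
    Borel Y (fst CD) /\ Borel Y (snd CD) /\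
    (forall y, P (fst (fst t)) y -> fst CD y) /\ (forall y, Q (snd (fst t)) y -> snd CD y) /\
    forall e, G (snd t) e -> fst CD (fst e) -> snd CD (snd e) -> False).
  { intros [[i j] k]. destruct (H i j k) as [C [D HCD]]. now exists (C, D). }
  destruct (choice _ H') as [W HW].
  (* If $C_{ijk} \times D_{ijk}$ are the given rectangles, the new one is $\bigcup_i\bigcap_{j,k}
     C_{ijk} \times \bigcap_i\bigcup_j\bigcap_k D_{ijk}$. An element of [G k] in it obtains [i] from
     the left side, then [j] from the right side, and so falls into the rectangle of [(i, j, k)]. *)
  exists (fun y => exists i, forall j k, fst (W (i, j, k)) y).
  exists (fun y => forall i, exists j, forall k, snd (W (i, j, k)) y).
  split; [|split; [|split; [|split]]].
  - apply (Borel_union Y (fun i y => forall j k, fst (W (i, j, k)) y)). intros i.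
    apply (Borel_inter Y (fun j y => forall k, fst (W (i, j, k)) y)). intros j.
    apply (Borel_inter Y (fun k y => fst (W (i, j, k)) y)). intros k. apply HW.
  - apply (Borel_inter Y (fun i y => exists j, forall k, snd (W (i, j, k)) y)). intros i.
    apply (Borel_union Y (fun j y => forall k, snd (W (i, j, k)) y)). intros j.
    apply (Borel_inter Y (fun k y => snd (W (i, j, k)) y)). intros k. apply HW.
  - intros y [i Pi]. exists i. intros j k. apply (HW (i, j, k)). exact Pi.
  - intros y [j Qj] i. exists j. intros k. apply (HW (i, j, k)). exact Qj.
  - intros e [k Gk] [i Hi] Hj. destruct (Hj i) as [j Hjk].
    exact (proj2 (proj2 (proj2 (proj2 (HW (i, j, k))))) e Gk (Hi j k) (Hjk k)).
Qed.

Lemma rectangle_separated_sub (P Q P' Q' : Y -> Prop) (G G' : Y * Y -> Prop) :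
  (forall y, P y -> P' y) -> (forall y, Q y -> Q' y) -> (forall e, G e -> G' e) ->
  rectangle_separated P' Q' G' -> rectangle_separated P Q G.
Proof.
  intros HP HQ HG [C [D [HC [HD [H1 [H2 H3]]]]]]. exists C, D. repeat split; eauto.
Qed.

Lemma Borel_ball (y : Y) r : Borel Y (fun z => (dist Y y z < r)%R).
Proof.
  apply Borel_open. intros z Hz. exists (r - dist Y y z)%R. split; [lra|].
  intros w Hw. pose proof (dist_tri Y y z w). lra.
Qed.

(** Lusin's separation argument on three branches at once: nonseparation passes to some triple of
    one-step refinements, all three branches converge, and the limits do not match because the
    product of [P] and [Q] misses [G]. *)
Lemma souslin_rectangle_separation (P Q : Y -> Prop) (G : Y * Y -> Prop) :
  souslin (pball Y) P -> souslin (pball Y) Q -> souslin (pball2 Y) G ->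
  (forall p q, P p -> Q q -> ~ G (p, q)) -> rectangle_separated P Q G.
Proof.
  intros [kP KP] [kQ KQ] [kG KG] Hdisj. apply NNPP. intros NS.
  pose (cP := fun n (a : nat -> nat * nat * nat) y =>
    P y /\ agree n (kP y) (fun i => fst (fst (a i)))).
  pose (cQ := fun n (a : nat -> nat * nat * nat) y =>
    Q y /\ agree n (kQ y) (fun i => snd (fst (a i)))).
  pose (cG := fun n (a : nat -> nat * nat * nat) e =>
    G e /\ agree n (kG e) (fun i => snd (a i))).
  destruct (branch_of_extensions
    (fun n a => ~ rectangle_separated (cP n a) (cQ n a) (cG n a)) (fun _ => (0, 0, 0)))
    as [a Ha].
  - intros n a b A H H'. apply H. revert H'.
    apply rectangle_separated_sub; intros y [Hy Ay]; (split; [exact Hy|]);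
      intros i Hi; rewrite Ay by exact Hi; now rewrite (A i Hi).
  - intros H. apply NS. revert H.
    apply rectangle_separated_sub; intros y Hy; (split; [exact Hy|intros i Hi; lia]).
  - intros n a H. apply NNPP. intros N. apply H.
    assert (Sep : forall i j k, rectangle_separated (cP (S n) (update a n (i, j, k)))
      (cQ (S n) (update a n (i, j, k))) (cG (S n) (update a n (i, j, k))))
      by (intros i j k; apply NNPP; intros F; apply N; now exists (i, j, k)).
    (* Each piece depends on one component of the new entry only; the other two are filled with
       0. *)
    apply rectangle_separated_sub with
      (fun y => exists i, cP (S n) (update a n (i, 0, 0)) y)
      (fun y => exists j, cQ (S n) (update a n (0, j, 0)) y)
      (fun e => exists k, cG (S n) (update a n (0, 0, k)) e).
    + intros y [Hy Ay]. exists (kP y n). split; [exact Hy|]. intros i Hi.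
      destruct (Nat.eq_dec i n) as [->|e]; [now rewrite update_same|].
      rewrite <- agree_update by lia. apply Ay. lia.
    + intros y [Hy Ay]. exists (kQ y n). split; [exact Hy|]. intros i Hi.
      destruct (Nat.eq_dec i n) as [->|e]; [now rewrite update_same|].
      rewrite <- agree_update by lia. apply Ay. lia.
    + intros y [Hy Ay]. exists (kG y n). split; [exact Hy|]. intros i Hi.
      destruct (Nat.eq_dec i n) as [->|e]; [now rewrite update_same|].
      rewrite <- agree_update by lia. apply Ay. lia.
    + apply rectangle_separated_union. intros i j k.
      apply rectangle_separated_sub with (4 := Sep i j k);
        intros y [Hy Ay]; (split; [exact Hy|]); intros l Hl; rewrite Ay by exact Hl;
        unfold update; now destruct (l =? n).
  - assert (B : Borel Y (fun _ => True)) by apply Borel_True.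
    (* The pieces along the branches are nonempty, as an empty one would be trivially separated; so
       the schemes yield limits. *)
    destruct (KP (fun i => fst (fst (a i)))) as [p [Pp Hp]].
    { intros n. apply NNPP. intros N. apply (Ha n). exists (fun _ => False), (fun _ => True).
      split; [apply Borel_False|split; [exact B|split; [|split; auto]]].
      intros y Hy. apply N. now exists y. }
    destruct (KQ (fun i => snd (fst (a i)))) as [q [Qq Hq]].
    { intros n. apply NNPP. intros N. apply (Ha n). exists (fun _ => True), (fun _ => False).
      split; [exact B|split; [apply Borel_False|split; [auto|split; auto]]].
      intros y Hy. apply N. now exists y. }
    destruct (KG (fun i => snd (a i))) as [[u v] [Guv Huv]].
    { intros n. apply NNPP. intros N. apply (Ha n). exists (fun _ => True), (fun _ => True).
      split; [exact B|split; [exact B|split; [auto|split; auto]]].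
      intros e He _ _. apply N. now exists e. }
    assert (D : p <> u \/ q <> v).
    { apply NNPP. intros N. apply (Hdisj p q Pp Qq).
      replace p with u by (apply NNPP; intros F; apply N; left; congruence).
      replace q with v by (apply NNPP; intros F; apply N; right; congruence). exact Guv. }
    (* Far along the branches, one side lies in the ball of half the distance around its limit,
       while the corresponding ends of the edges lie in a disjoint ball. *)
    destruct D as [D|D]; apply dist_pos in D.
    + destruct (Hp (dist Y p u / 2)%R ltac:(lra)) as [n Hn].
      destruct (Huv (dist Y p u / 2)%R ltac:(lra)) as [n' Hn'].
      apply (Ha (max n n')). exists (fun z => (dist Y p z < dist Y p u / 2)%R), (fun _ => True).
      split; [apply Borel_ball|split; [exact B|split; [|split; [auto|]]]].
      * intros y [Hy Ay]. apply Hn; [exact Hy|]. apply agree_le with (2 := Ay). lia.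
      * intros e [Ge Ae] H1 _. destruct (Hn' e Ge) as [H2 _].
        { apply agree_le with (2 := Ae). lia. }
        cbn in H2. pose proof (dist_tri Y p (fst e) u) as H3.
        rewrite (dist_sym Y (fst e) u) in H3. lra.
    + destruct (Hq (dist Y q v / 2)%R ltac:(lra)) as [n Hn].
      destruct (Huv (dist Y q v / 2)%R ltac:(lra)) as [n' Hn'].
      apply (Ha (max n n')). exists (fun _ => True), (fun z => (dist Y q z < dist Y q v / 2)%R).
      split; [exact B|split; [apply Borel_ball|split; [auto|split; [|]]]].
      * intros y [Hy Ay]. apply Hn; [exact Hy|]. apply agree_le with (2 := Ay). lia.
      * intros e [Ge Ae] _ H1. destruct (Hn' e Ge) as [_ H2].
        { apply agree_le with (2 := Ae). lia. }
        cbn in H2. pose proof (dist_tri Y q (snd e) v) as H3.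
        rewrite (dist_sym Y (snd e) v) in H3. lra.
Qed.

End Rectangles.

(** * Labelled digraphs *)

Fixpoint walk {T : Type} (B : T -> T -> Prop) (n : nat) (x z : T) : Prop :=
  match n with 0 => x = z | S n => exists y, B x y /\ walk B n y z end.

Definition unbalanced {T : Type} (B : T -> T -> Prop) (j : nat) : Prop :=
  exists x y z, B x y /\ walk B j x z /\ walk B j y z.

(* [compose tau l] reindexes by the labels of [l], the head acting first on points. *)
Fixpoint compose (tau : nat -> nat -> nat) (l : list nat) (p : nat) : nat :=
  match l with nil => p | cons n l => tau n (compose tau l p) end.

(** The head carries the largest label. It acts first on points, hence last on indices. *)
Fixpoint decreasing_below (N : nat) (l : list nat) : Prop :=
  match l with nil => True | cons n l => n < N /\ decreasing_below n l end.

Section Labels.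
Variables (Y : Polish) (B : Y -> Y -> Prop) (h : Y -> Baire) (tau : nat -> nat -> nat).
Hypothesis B_irreflexive : digraph Y B.
Hypothesis B_analytic : analytic2 Y B.
Hypothesis h_injective : injective h.
Hypothesis h_borel : borel_fun Y Baire h.

Definition labelled (n : nat) (y y' : Y) : Prop := B y y' /\ forall p, h y' p = h y (tau n p).

Hypothesis B_labelled : forall y y', B y y' -> exists n, labelled n y y'.

Lemma labelled_souslin n : souslin (pball2 Y) (fun e => labelled n (fst e) (snd e)).
Proof.
  pose proof (pball_separated Y) as S1. pose proof (pball2_separated Y) as S2.
  (* Naming the common value [v] splits each equation into conditions on one end of the edge at a
     time. *)
  apply souslin_ext with (fun e => forall p, exists v,
    (B (fst e) (snd e) /\ h (snd e) p = v) /\ h (fst e) (tau n p) = v).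
  { intros e. split.
    - intros H. split.
      + destruct (H 0) as [v [[Be _] _]]. exact Be.
      + intros p. destruct (H p) as [v [[_ E] E']]. congruence.
    - intros [Be E] p. exists (h (snd e) p). auto. }
  apply (souslin_inter (pball2 Y) (fun p e => exists v,
    (B (fst e) (snd e) /\ h (snd e) p = v) /\ h (fst e) (tau n p) = v)); [exact S2|].
  intros p.
  apply (souslin_union (pball2 Y) (fun v e =>
    (B (fst e) (snd e) /\ h (snd e) p = v) /\ h (fst e) (tau n p) = v)).
  intros v.
  apply (souslin_preimage (pball2 Y) (pball Y) fst
    (fun e => B (fst e) (snd e) /\ h (snd e) p = v) (fun y => h y (tau n p) = v) S1).
  - apply fst_ball_continuous.
  - apply (souslin_preimage (pball2 Y) (pball Y) snd
      (fun e => B (fst e) (snd e)) (fun y => h y p = v) S1).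
    + apply snd_ball_continuous.
    + now apply analytic2_souslin.
    + apply Borel_souslin. now apply Borel_coordinate.
  - apply Borel_souslin. now apply Borel_coordinate.
Qed.

(* A point [y] gets the color [(p, v)] for a coordinate [p] at which [h y] takes the value
   [v] but the image of [h y] under the label does not. *)
Lemma small_of_finitely_many_labels N (C : Y -> Prop) : Borel Y C ->
  (forall y y', C y -> C y' -> B y y' -> exists n, n < N /\ labelled n y y') ->
  small Y B C.
Proof.
  revert C. induction N as [|N IH]; intros C HC H.
  - apply small_independent; [exact HC|]. intros y y' Cy Cy' Byy'.
    destruct (H y y' Cy Cy' Byy') as [n [Hn _]]. lia.
  - pose (V := fun k y => h y (fst_of k) = snd_of k /\ ~ h y (tau N (fst_of k)) = snd_of k).
    assert (HV : forall k, Borel Y (V k)).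
    { intros k. apply Borel_and; [now apply Borel_coordinate|].
      apply Borel_compl. now apply Borel_coordinate. }
    apply small_sub with (fun y => (exists k, C y /\ V k y) \/ (C y /\ forall k, ~ V k y)).
    { intros y Cy. destruct (classic (exists k, V k y)) as [[k Hk]|F].
      - left. now exists k.
      - right. split; [exact Cy|]. intros k Vk. apply F. now exists k. }
    apply small_or.
    + apply (small_union Y B (fun k y => C y /\ V k y)). intros k. apply IH.
      * now apply Borel_and.
      * intros y y' [Cy [V1 V2]] [Cy' [V1' V2']] Byy'.
        destruct (H y y' Cy Cy' Byy') as [n [Hn L]]. exists n. split; [|exact L].
        assert (n <> N); [|lia]. intros ->. apply V2. rewrite <- V1'. symmetry. apply L.
    (* An uncolored [h y] is invariant under label [N], so an edge with this label would be a loop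
       by injectivity. *)
    + apply IH.
      * apply Borel_and; [exact HC|]. apply (Borel_inter Y (fun k y => ~ V k y)).
        intros k. now apply Borel_compl.
      * intros y y' [Cy F] [Cy' F'] Byy'.
        destruct (H y y' Cy Cy' Byy') as [n [Hn L]]. exists n. split; [|exact L].
        assert (n <> N); [|lia]. intros ->. apply (B_irreflexive y).
        replace y' with y in Byy'; [exact Byy'|]. apply h_injective.
        apply functional_extensionality. intros p. rewrite (proj2 L p).
        apply NNPP. intros E. apply (F (to_nat (p, h y p))). unfold V.
        rewrite fst_of_pair, snd_of_pair. split; [reflexivity|]. congruence.
Qed.

Definition source (n : nat) (S : Y -> Prop) (y : Y) : Prop :=
  exists e, ((labelled n (fst e) (snd e) /\ S (fst e)) /\ S (snd e)) /\ fst e = y.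

Lemma source_souslin n S : souslin (pball Y) S -> souslin (pball Y) (source n S).
Proof.
  intros HS. pose proof (pball_separated Y) as S1.
  apply (souslin_image (pball2 Y) (pball Y) fst); [apply fst_ball_continuous|].
  apply (souslin_preimage (pball2 Y) (pball Y) snd
    (fun e => labelled n (fst e) (snd e) /\ S (fst e)) S S1); [apply snd_ball_continuous| |exact HS].
  apply (souslin_preimage (pball2 Y) (pball Y) fst
    (fun e => labelled n (fst e) (snd e)) S S1); [apply fst_ball_continuous| |exact HS].
  apply labelled_souslin.
Qed.

(** Otherwise the points of [S] that start an edge inside [S] with a label at least [N] are covered
    by countably many independent Borel sets. The rest [P] of [S] has no such edge. Rectangle
    separation encloses [P] in the Borel set [D] intersected with [D'], where only labels below [N]
    occur, and which is therefore small. *)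
Lemma not_small_source S N : souslin (pball Y) S -> ~ small Y B S ->
  exists n, N <= n /\ ~ small Y B (source n S).
Proof.
  intros HS NS. apply NNPP. intros F.
  assert (Hs : small Y B (fun y => exists n, source (N + n) S y)).
  { apply (small_union Y B (fun n => source (N + n) S)). intros n. apply NNPP. intros G.
    apply F. exists (N + n). split; [lia|exact G]. }
  destruct Hs as [C [HB [HI HC]]].
  pose (P := fun y => S y /\ ~ exists i, C i y).
  assert (HP : souslin (pball Y) P).
  { apply souslin_and; [apply pball_separated|exact HS|]. apply Borel_souslin.
    now apply Borel_union. }
  destruct (souslin_rectangle_separation Y P P
    (fun e => exists n, labelled (N + n) (fst e) (snd e))) as [D [D' [HD [HD' [PD [PD' E]]]]]].
  - exact HP.
  - exact HP.
  - apply (souslin_union (pball2 Y) (fun n e => labelled (N + n) (fst e) (snd e))).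
    intros n. apply labelled_souslin.
  - intros y y' [Sy Cy] [Sy' Cy'] [n L]. apply Cy, HC. exists n, (y, y').
    cbn in *. tauto.
  - apply NS. apply small_sub with (fun y => (D y /\ D' y) \/ exists i, C i y).
    { intros y Sy. destruct (classic (exists i, C i y)) as [Cy|Cy]; [now right|left].
      split; [apply PD|apply PD']; now split. }
    apply small_or.
    + apply small_of_finitely_many_labels with N; [now apply Borel_and|].
      intros y y' [Dy _] [_ Dy'] Byy'. destruct (B_labelled y y' Byy') as [n L].
      exists n. split; [|exact L]. destruct (le_lt_dec N n) as [l|l]; [exfalso|exact l].
      apply (E (y, y')); [|exact Dy|exact Dy'].
      exists (n - N). cbn. now replace (N + (n - N)) with n by lia.
    + exists C. split; [exact HB|split; [exact HI|auto]].
Qed.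

Fixpoint labelled_walk (l : list nat) (x z : Y) : Prop :=
  match l with
  | nil => x = z
  | cons n l => exists y, labelled n x y /\ labelled_walk l y z
  end.

Lemma labelled_walk_walk l x z : labelled_walk l x z -> walk B (length l) x z.
Proof.
  revert x. induction l as [|n l IH]; intros x; [auto|].
  intros [y [[Bxy _] W]]. exists y. split; [exact Bxy|now apply IH].
Qed.

Lemma labelled_walk_compose l x z : labelled_walk l x z ->
  forall p, h z p = h x (compose tau l p).
Proof.
  revert x. induction l as [|n l IH]; intros x.
  - intros <- p. reflexivity.
  - intros [y [[_ L] W]] p. rewrite (IH y W p). apply L.
Qed.

(** Passing from [S] to the sources of its edges with one label [n >= N] prepends [n] to all walks,
    and [not_small_source] keeps the set large. *)
Lemma uniform_labelled_walks (k : nat) : uncountable_borel_chromatic Y B ->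
  exists N S l, souslin (pball Y) S /\ ~ small Y B S /\ length l = k /\
    decreasing_below N l /\ forall y, S y -> exists z, labelled_walk l y z.
Proof.
  intros HU. induction k as [|k [N [S [l [HS [NS [Hl [Hd HW]]]]]]]].
  - exists 0, (fun _ => True), nil.
    split; [apply souslin_full|split; [|split; [reflexivity|split; [exact I|]]]].
    + intros H. exact (colorable_of_small Y B H HU).
    + intros y _. now exists y.
  - destruct (not_small_source S N HS NS) as [n [Hn NSn]].
    exists (Datatypes.S n), (source n S), (cons n l).
    split; [now apply source_souslin|split; [exact NSn|split; [cbn; now rewrite Hl|split]]].
    + cbn. split; [lia|]. clear - Hd Hn. destruct l as [|m l]; [exact I|].
      cbn in *. split; [lia|tauto].
    + intros y [[u v] [[[L Su] Sv] <-]]. destruct (HW v Sv) as [z Hz].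
      exists z, v. now split.
Qed.

Lemma unbalanced_of_absorption k : uncountable_borel_chromatic Y B ->
  (forall N l m p, length l = k -> decreasing_below N l -> N <= m ->
     tau m (compose tau l p) = compose tau l p) ->
  unbalanced B k.
Proof.
  intros HU H. destruct (uniform_labelled_walks k HU) as [N [S [l [HS [NS [Hl [Hd HW]]]]]]].
  destruct (not_small_source S N HS NS) as [m [Hm NSm]].
  assert (Ex : exists y, source m S y).
  { apply NNPP. intros F. apply NSm. apply small_sub with (fun _ => False).
    - intros y Hy. apply F. now exists y.
    - apply small_independent; [apply Borel_False|tauto]. }
  destruct Ex as [_ [[y y'] [[[[Byy' L] Sy] Sy'] _]]]. cbn in Byy', L, Sy, Sy'.
  destruct (HW y Sy) as [z Hz]. destruct (HW y' Sy') as [z' Hz'].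
  (* Both walks use the labels [l], so [h z'] and [h z] differ only by the reindexing [tau m] of the
     edge from [y] to [y'], which absorption erases. *)
  assert (E : z' = z).
  { apply h_injective. apply functional_extensionality. intros p.
    rewrite (labelled_walk_compose l y' z' Hz' p), (labelled_walk_compose l y z Hz p), L.
    now rewrite (H N l m p Hl Hd Hm). }
  subst z'. exists y, y', z. rewrite <- Hl.
  split; [exact Byy'|split; now apply labelled_walk_walk].
Qed.

End Labels.

(** * The digraphs *)

Definition point (j i c : nat) : nat := to_nat (j, to_nat (i, c)).
Definition layer (p : nat) : nat := fst_of p.
Definition coord (p : nat) : nat := fst_of (snd_of p).
Definition column (p : nat) : nat := snd_of (snd_of p).

Lemma layer_point j i c : layer (point j i c) = j.
Proof. apply fst_of_pair. Qed.

Lemma coord_point j i c : coord (point j i c) = i.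
Proof. unfold coord, point. now rewrite snd_of_pair, fst_of_pair. Qed.

Lemma column_point j i c : column (point j i c) = c.
Proof. unfold column, point. now rewrite !snd_of_pair. Qed.

Lemma point_eta p : point (layer p) (coord p) (column p) = p.
Proof. unfold point, layer, coord, column. now rewrite (pair_fst_snd (snd_of p)), pair_fst_snd. Qed.

Lemma point_inj j i c j' i' c' :
  point j i c = point j' i' c' -> j = j' /\ i = i' /\ c = c'.
Proof.
  intros E. pose proof (f_equal layer E) as H1. pose proof (f_equal coord E) as H2.
  pose proof (f_equal column E) as H3.
  rewrite !layer_point in H1. rewrite !coord_point in H2. rewrite !column_point in H3. auto.
Qed.

(* Reindexing by [shift K a] moves layer [j] onto layer [j+1] beyond coordinate [a], for
   [j < K], and fills layer [0] beyond [a] with the columns of its coordinate [a]. *)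
Definition shift (K a p : nat) : nat :=
  match layer p with
  | 0 => if coord p <? a then p else point 0 a (to_nat (coord p, column p))
  | S j => if ((a <? coord p) && (S j <=? K))%bool then point j (coord p) (column p) else p
  end.

Lemma shift_point_0 K a i c :
  shift K a (point 0 i c) = if i <? a then point 0 i c else point 0 a (to_nat (i, c)).
Proof. unfold shift. now rewrite layer_point, coord_point, column_point. Qed.

Lemma shift_point_S K a j i c :
  shift K a (point (S j) i c) =
  if ((a <? i) && (S j <=? K))%bool then point j i c else point (S j) i c.
Proof. unfold shift. now rewrite layer_point, coord_point, column_point. Qed.

(** Layer 0 is sent to coordinates at most [a]. Indices moved down a layer land beyond coordinate
    [a] in layers below [K], whereas fixed indices of positive layers have coordinate at most [a] or
    layer beyond [K]. *)
Lemma shift_injective K a : injective (shift K a).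
Proof.
  intros p q. rewrite <- (point_eta p), <- (point_eta q).
  generalize (layer p) (coord p) (column p) (layer q) (coord q) (column q).
  intros j i c j' i' c'.
  destruct j as [|j], j' as [|j']; rewrite ?shift_point_0, ?shift_point_S;
    repeat match goal with
    | |- context [?x <? ?y] => destruct (Nat.ltb_spec x y)
    | |- context [?x <=? ?y] => destruct (Nat.leb_spec x y)
    end; cbn [andb]; intros E; apply point_inj in E; destruct E as [E1 [E2 E3]];
    try lia; try (subst; reflexivity).
  { apply (f_equal of_nat) in E3. rewrite !cancel_of_to in E3. now inversion E3. }
  all: inversion E1; subst; reflexivity.
Qed.

Lemma shift_eventually_id K p : exists N, forall a, N <= a -> shift K a p = p.
Proof.
  exists (S (coord p)). intros a Ha. unfold shift.
  destruct (layer p); [destruct (Nat.ltb_spec (coord p) a)|destruct (Nat.ltb_spec a (coord p))];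
    try lia; reflexivity.
Qed.

(* Each label either moves an index one layer down, or brings it into the region
   which all larger labels fix. *)
Lemma shift_absorption K N l m p : length l = S K -> decreasing_below N l -> N <= m ->
  shift K m (compose (shift K) l p) = compose (shift K) l p.
Proof.
  assert (Claim : forall l N, decreasing_below N l ->
    (forall m, N <= m -> shift K m (compose (shift K) l p) = compose (shift K) l p) \/
    (* As long as an index is not absorbed, every label has cost it one layer; for [length l = S K]
       this alternative is impossible. *)
    layer (compose (shift K) l p) + length l <= K).
  { clear. induction l as [|n l IH]; intros N Hd; cbn [compose length].
    - destruct (le_lt_dec (layer p) K) as [L|L]; [right; lia|left].
      intros m _. unfold shift. destruct (layer p) as [|j]; [lia|].
      destruct (Nat.leb_spec (S j) K); [lia|]. now rewrite Bool.andb_false_r.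
    - destruct Hd as [Hn Hd]. destruct (IH n Hd) as [F|L].
      + left. intros m Hm. rewrite (F n (le_n n)). apply F. lia.
      + set (q := compose (shift K) l p) in *. clearbody q.
        rewrite <- (point_eta q). generalize (coord q) (column q). revert L.
        generalize (layer q). clear - Hn. intros [|j] L i c.
        (* An index of layer 0 lands on a coordinate at most [n], which lies below every
           [m >= N]. *)
        * left. intros m Hm. rewrite !shift_point_0.
          destruct (Nat.ltb_spec i n); rewrite shift_point_0;
            [destruct (Nat.ltb_spec i m)|destruct (Nat.ltb_spec n m)]; try lia; reflexivity.
        * rewrite !shift_point_S. destruct (Nat.ltb_spec n i), (Nat.leb_spec (S j) K); try lia; cbn [andb].
          -- right. rewrite layer_point. lia.
          -- left. intros m Hm. rewrite shift_point_S.
             destruct (Nat.ltb_spec m i); [lia|]. reflexivity. }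
  intros Hl Hd Hm. destruct (Claim l N Hd) as [F|L]; [auto|lia].
Qed.

(** * The digraphs are analytic and not countably Borel colorable *)

Definition moved (K a : nat) (x : nat -> nat) (n p : nat) : Prop :=
  layer p = 0 /\ n <= coord p /\ x p <> x (shift K a p).

(** The edge changes layer 0 even modulo eventual equality. This excludes loops and, later, short
    unbalanced patterns. *)
Definition legal (K a : nat) (x : nat -> nat) : Prop := forall n, exists p, moved K a x n p.

Definition layered_graph (K : nat) : Baire -> Baire -> Prop := reindex_graph (shift K) (legal K).

Lemma illegal_meager K a : meager (fun x => ~ legal K a x).
Proof.
  apply meager_sub with (fun x => exists n, forall p, ~ moved K a x n p).
  { intros x H. apply NNPP. intros N. apply H. intros n. apply NNPP. intros F.
    apply N. exists n. intros p Hp. apply F. now exists p. }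
  apply (meager_union (fun n x => forall p, ~ moved K a x n p)). intros n.
  apply nowhere_dense_meager. intros x m.
  (* The coordinate is beyond [n], beyond [a] so that the shift moves [p], and beyond [m] so that
     [x] can be altered at [p] without leaving the cylinder. *)
  pose (i := n + m + a + 1). pose (p := point 0 i 0).
  assert (Hs : shift K a p = point 0 a (to_nat (i, 0))).
  { unfold p. rewrite shift_point_0. destruct (Nat.ltb_spec i a); [unfold i in *; lia|reflexivity]. }
  assert (Hne : shift K a p <> p).
  { rewrite Hs. unfold p. intros E. apply point_inj in E. unfold i in *. lia. }
  assert (Hp : m <= p).
  { pose proof (to_nat_non_decreasing 0 (to_nat (i, 0))).
    pose proof (to_nat_non_decreasing i 0). unfold p, point, i in *. lia. }
  exists (fun q => if q =? p then S (x (shift K a p)) else x q), (m + S p + S (shift K a p)).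
  split; [lia|split].
  - intros q Hq. destruct (Nat.eqb_spec q p); [lia|reflexivity].
  - intros z Az H. apply (H p). split; [apply layer_point|split].
    + unfold p. rewrite coord_point. unfold i. lia.
    + rewrite <- (Az p), <- (Az (shift K a p)) by lia.
      rewrite Nat.eqb_refl. destruct (Nat.eqb_spec (shift K a p) p); [contradiction|]. lia.
Qed.

Definition code_base (z : nat -> nat) (m : nat) : nat := fst_of (z m).
Definition code_label (z : nat -> nat) : nat := fst_of (snd_of (z 0)).
Definition code_witness (z : nat -> nat) (n : nat) : nat := snd_of (snd_of (z n)).

(* [z] codes a point, a label and a function witnessing legality of this pair. *)
Definition edge_code (K : nat) (z : nat -> nat) : Prop :=
  forall n, moved K (code_label z) (code_base z) n (code_witness z n).

(** Condition [n] reads the code at 0, at [n], at the witness and at its shift only, so it survives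
    pointwise limits. Coding the witnesses is what turns legality into a closed condition. *)
Lemma edge_code_closed K : forall u l,
  pointwise_limit (fun z : {z | edge_code K z} => proj1_sig z) u l ->
  exists t : {z | edge_code K z}, proj1_sig t = l.
Proof.
  intros u l H.
  assert (E : edge_code K l); [|now exists (exist _ l E)].
  intros n. set (p := code_witness l n).
  set (q := shift K (code_label l) p).
  destruct (H 0) as [N0 H0], (H n) as [N1 H1], (H p) as [N2 H2], (H q) as [N3 H3].
  pose (k := N0 + N1 + N2 + N3).
  specialize (H0 k ltac:(lia)). specialize (H1 k ltac:(lia)).
  specialize (H2 k ltac:(lia)). specialize (H3 k ltac:(lia)).
  destruct (u k) as [z Hz]. cbn in *. specialize (Hz n).
  unfold moved, code_witness, code_label, code_base in *. subst p q.
  now rewrite H0, H1, H2, H3 in Hz.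
Qed.

Lemma proj1_injective (P : (nat -> nat) -> Prop) : injective (fun z : {z | P z} => proj1_sig z).
Proof.
  intros [z Hz] [z' Hz'] E. cbn in E. subst z'. f_equal. apply proof_irrelevance.
Qed.

Lemma subspace_continuous (T : Type) (iota : T -> nat -> nat) inj clo
    (f : subspace T iota inj clo -> Baire) :
  (forall z m, exists N, forall z', agree N (iota z) (iota z') -> f z m = f z' m) ->
  continuous (subspace T iota inj clo) Baire f.
Proof.
  intros H z eps He. destruct (inv_S_small eps He) as [n Hn].
  assert (B : forall k, exists N, forall z', agree N (iota z) (iota z') -> agree k (f z) (f z')).
  { induction k as [|k [N IH]].
    - exists 0. intros z' _ i Hi. lia.
    - destruct (H z k) as [N' HN']. exists (max N N'). intros z' A i Hi.
      destruct (Nat.eq_dec i k) as [->|e].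
      + apply HN'. apply agree_le with (2 := A). lia.
      + apply (IH z'); [apply agree_le with (2 := A)|]; lia. }
  destruct (B (S n)) as [N HN]. exists (/ INR (S N))%R. split; [apply inv_S_pos|].
  intros z' Hz'. apply Rlt_trans with (2 := Hn). apply agree_bdist_lt. apply HN.
  apply agree_le with (S N); [lia|]. now apply bdist_lt_agree.
Qed.

Lemma layered_graph_analytic K : analytic2 Baire (layered_graph K).
Proof.
  exists (subspace {z | edge_code K z} _ (proj1_injective _) (edge_code_closed K)).
  exists (fun z => code_base (proj1_sig z)).
  exists (fun z p => code_base (proj1_sig z) (shift K (code_label (proj1_sig z)) p)).
  split; [|split].
  - apply subspace_continuous. intros z m. exists (S m). intros z' A.
    unfold code_base. now rewrite (A m) by lia.
  - apply subspace_continuous. intros z m.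
    (* This length also covers entry 0, so [z'] has the same label as [z]. *)
    exists (S (shift K (code_label (proj1_sig z)) m)). intros z' A.
    unfold code_label in *. rewrite <- (A 0) by lia. unfold code_base. now rewrite A by lia.
  - intros x y. split.
    + intros [a [-> L]]. destruct (choice _ L) as [w Hw].
      pose (z := fun m => to_nat (x m, to_nat (a, w m))).
      assert (E1 : code_base z = x).
      { apply functional_extensionality. intros m. unfold code_base, z. apply fst_of_pair. }
      assert (E2 : code_label z = a).
      { unfold code_label, z. now rewrite snd_of_pair, fst_of_pair. }
      assert (Hz : edge_code K z).
      { intros n. rewrite E1, E2. unfold code_witness, z. rewrite !snd_of_pair. apply Hw. }
      exists (exist _ z Hz). cbn [proj1_sig]. rewrite E1, E2. split; reflexivity.
    + intros [[z Hz] [<- <-]]. cbn [proj1_sig]. exists (code_label z). split; [reflexivity|].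
      intros n. exists (code_witness z n). apply Hz.
Qed.

Lemma layered_graph_in_class K : in_class Baire (layered_graph K).
Proof.
  split; [|split].
  - intros x [a [E L]]. destruct (L 0) as [p [_ [_ H]]]. apply H.
    exact (f_equal (fun f => f p) E).
  - apply layered_graph_analytic.
  - apply uncountable_of_not_small. apply reindex_graph_not_small.
    + apply shift_injective.
    + apply shift_eventually_id.
    + apply illegal_meager.
Qed.

(** * Absence of short unbalanced patterns, and the conclusion *)

Definition same_tail (j : nat) (x : nat -> nat) (j' : nat) (y : nat -> nat) : Prop :=
  exists N, forall i c, N <= i -> x (point j i c) = y (point j' i c).

Lemma same_tail_trans j x j' y j'' z :
  same_tail j x j' y -> same_tail j' y j'' z -> same_tail j x j'' z.
Proof.
  intros [N H] [N' H']. exists (max N N'). intros i c Hi. rewrite H, H'; auto; lia.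
Qed.

Lemma layered_graph_same_tail K j x y : j < K -> layered_graph K x y -> same_tail j x (S j) y.
Proof.
  intros Hj [a [-> _]]. exists (S a). intros i c Hi. rewrite shift_point_S.
  destruct (Nat.ltb_spec a i), (Nat.leb_spec (S j) K); try lia. reflexivity.
Qed.

Lemma walk_same_tail K n j x z : j + n <= K -> walk (layered_graph K) n x z ->
  same_tail j x (j + n) z.
Proof.
  revert j x. induction n as [|n IH]; intros j x Hj.
  - intros ->. rewrite Nat.add_0_r. exists 0. auto.
  - intros [y [E W]]. apply same_tail_trans with (S j) y.
    + apply layered_graph_same_tail with K; [lia|exact E].
    + replace (j + S n) with (S j + n) by lia. apply IH; [lia|exact W].
Qed.

(** Both walks carry layer 0 of their start to layer [j] of [z]. Hence [x] and [y] eventually agree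
    on layer 0, against the legality of the edge between them. *)
Lemma layered_graph_not_unbalanced K j : j <= K -> ~ unbalanced (layered_graph K) j.
Proof.
  intros Hj [x [y [z [[a [E L]] [Wx Wy]]]]].
  destruct (walk_same_tail K j 0 x z Hj Wx) as [N H].
  destruct (walk_same_tail K j 0 y z Hj Wy) as [N' H'].
  destruct (L (N + N')) as [p [Lp [Cp Np]]]. apply Np.
  pose proof (H (coord p) (column p) ltac:(lia)) as E1.
  pose proof (H' (coord p) (column p) ltac:(lia)) as E2.
  rewrite <- E2, E, <- Lp, point_eta in E1. exact E1.
Qed.

Lemma walk_map {T T' : Type} (B : T -> T -> Prop) (A : T' -> T' -> Prop) (h : T -> T') n x z :
  (forall x y, B x y -> A (h x) (h y)) -> walk B n x z -> walk A n (h x) (h z).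
Proof.
  intros H. revert x. induction n as [|n IH]; intros x.
  - intros ->. reflexivity.
  - intros [y [E W]]. exists (h y). split; [auto|now apply IH].
Qed.

Lemma unbalanced_map {T T' : Type} (B : T -> T -> Prop) (A : T' -> T' -> Prop) (h : T -> T') j :
  (forall x y, B x y -> A (h x) (h y)) -> unbalanced B j -> unbalanced A j.
Proof.
  intros H [x [y [z [E [W W']]]]]. exists (h x), (h y), (h z).
  split; [auto|split; now apply (walk_map B A h)].
Qed.

Lemma unbalanced_below_layered_graph (C : Cls) (K : nat) (Y : Polish) (B : Y -> Y -> Prop) :
  in_class Y B -> inj_reduces C Y B Baire (layered_graph K) -> unbalanced B (S K).
Proof.
  intros [Hd [Ha HU]] [h [Hi [Hadm Hh]]].
  (* Continuous maps are Borel, so both classes of maps are treated at once. *)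
  assert (Hb : borel_fun Y Baire h).
  { destruct C; [now apply continuous_borel|exact Hadm]. }
  apply (unbalanced_of_absorption Y B h (shift K)); auto.
  - intros y y' Byy'. destruct (Hh y y' Byy') as [a [E _]]. exists a.
    split; [exact Byy'|]. intros p. now rewrite E.
  - intros N l m p. apply shift_absorption.
Qed.

Theorem theorem1p5 :
  forall (C : Cls) (N : nat) (Xs : nat -> Polish) (As : forall i, Xs i -> Xs i -> Prop),
    (forall i, (i < N)%nat -> in_class (Xs i) (As i)) ->
    ~ (forall (X : Polish) (A : X -> X -> Prop), in_class X A ->
         exists i, (i < N)%nat /\ inj_reduces C (Xs i) (As i) X A).
Proof.
  intros C N Xs As HAs Hbasis.
  (* The number [j i] is the length of one pattern of member [i], with default 0 if it has none; [K]
     will exceed all of these. *)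
  assert (J : forall i, exists j, (exists j', unbalanced (As i) j') -> unbalanced (As i) j).
  { intros i. destruct (classic (exists j, unbalanced (As i) j)) as [[j Hj]|F];
      [now exists j|exists 0; tauto]. }
  destruct (choice _ J) as [j Hj]. destruct (bounded_values j N) as [K HK].
  destruct (Hbasis Baire (layered_graph K) (layered_graph_in_class K)) as [i [Hi R]].
  apply (layered_graph_not_unbalanced K (j i)); [specialize (HK i Hi); lia|].
  (* Lying below the digraph for [K], member [i] has a pattern of length [S K], so [j i] is not a
     default. Its pattern of length [j i < K] is then mapped into a digraph without such
     patterns. *)
  assert (U : unbalanced (As i) (j i)).
  { apply Hj. exists (S K).
    apply (unbalanced_below_layered_graph C K (Xs i) (As i) (HAs i Hi) R). }
  destruct R as [h [_ [_ Hh]]]. exact (unbalanced_map (As i) (layered_graph K) h (j i) Hh U).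
Qed.
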